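(* Let $\{e_i\}$ satisfy the strong invariance principle with $\Delta_n=n^{1/4}\log(n)$, i.e. there are standard Brownian motions $\{B_t\}$, $\{B_t^*\}$ with $$\max_{1\le i\le n}|S_i-\tau B_i|=o_{\mathrm{a.s.}}(\Delta_n)\quad\text{and}\quad \max_{1\le i\le n}|S_i^*-\tau^*B_i^*|=o_{\mathrm{a.s.}}(\Delta_n),$$ and assume $$\frac{r_n\Delta_n}{\Sigma_n}+\frac{r_n^*\Delta_n+\Sigma_n^{*2}}{\Sigma_n^2}\to0\qquad\text{and}\qquad \Bigl(\sum_{i=1}^n\sigma_i^3\Bigr)^2\Bigl(\sum_{i=1}^n\sigma_i^2\Bigr)^{-3}\to0.$$ Let $\{\alpha_i\}$ be i.i.d. random variables independent of $\{e_i\}$ with $E(|\alpha_i|^3)<\infty$, $E(\alpha_i)=0$, $E(\alpha_i^2)=1$. Define $$H_n=\frac{\sum_{i=1}^n\sigma_ie_i}{\sqrt{\sum_{i=1}^n\sigma_i^2e_i^2}},\qquad H_n^*=\frac{\sum_{i=1}^n\xi_i}{\sqrt{\sum_{i=1}^n(\xi_i-\bar\xi)^2}},\qquad \xi_i=\sigma_ie_i\alpha_i,\quad \bar\xi=\frac{\xi_1+\cdots+\xi_n}{n}.$$ Let $\hat\tau$ be a consistent estimate of $\tau$, and denote by $P^*$ the conditional law given $\{e_i\}$. Then $$\sup_{x\in\mathbb{R}}\bigl|P^*(H_n^*\le x)-P(H_n/\hat\tau\le x)\bigr|\to0\quad\text{in probability}.$$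
   Context: Setting: $\{e_i\}$ is a stationary time series with $E(e_i)=0$, $E(e_i^2)=1$; $\sigma_i>0$ are deterministic constants (which may depend on $n$). $S_i=\sum_{j=1}^ie_j$, $S_i^*=\sum_{j=1}^i(e_j^2-1)$. $\tau^2$ and $\tau^{*2}$ are the long-run variances of $\{e_i\}$ and $\{e_i^2-1\}$ (assumed well defined, so in particular $E(e_i^4)<\infty$), where the long-run variance of a stationary process with autocovariances $\gamma_k$ is $\gamma_0+2\sum_{k\ge1}\gamma_k$; it is assumed that $\tau^2>0$, and $\tau>0$, $\tau^*\ge0$ are the square roots. Strong invariance principles are understood on a possibly enlarged probability space on which the process is redefined without changing its distribution; the two Brownian motions may be defined on different probability spaces. Notation: $r_n=|\sigma_n|+\sum_{i=2}^n|\sigma_i-\sigma_{i-1}|$, $r_n^*=|\sigma_n^2|+\sum_{i=2}^n|\sigma_i^2-\sigma_{i-1}^2|$; $\Sigma_n^2=\sum_{i=1}^n\sigma_i^2$, $\Sigma_n^{*2}=\bigl(\sum_{i=1}^n\sigma_i^4\bigr)^{1/2}$. Consistent means $\hat\tau\to\tau$ in probability as $n\to\infty$. *)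

(* Defs.v *)
From HB Require Import structures.
From mathcomp Require Import all_boot all_order all_algebra.
From mathcomp Require Import all_classical all_reals all_analysis.
Import Order.TTheory GRing.Theory Num.Theory.
Import numFieldNormedType.Exports.
Set Implicit Arguments.
Unset Strict Implicit.
Unset Printing Implicit Defensive.
Local Open Scope classical_set_scope.
Local Open Scope ring_scope.

(* Time series, triangular arrays and multipliers are indexed by i >= 1: the
   value at index 0 of such a family is junk that no definition below reads.
   All quotients use x / 0 = 0; this only matters on the events where a
   self-normalizing denominator (or tau-hat) vanishes. *)

Definition same_law d d' (T : measurableType d) (T' : measurableType d')
    (R : realType) (P : probability T R) (P' : probability T' R)
    (X : nat -> T -> R) (X' : nat -> T' -> R) : Prop :=
  forall (m : nat) (A : set (m.-tuple R)), measurable A ->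
    P [set w | A [tuple X i.+1 w | i < m]]
    = P' [set w | A [tuple X' i.+1 w | i < m]].

Definition strictly_stationary d (T : measurableType d) (R : realType)
    (P : probability T R) (X : nat -> T -> R) : Prop :=
  forall h : nat, same_law P P X (fun i => X (i + h)%N).

Definition mutually_independent d (T : measurableType d) (R : realType)
    (P : probability T R) (I : eqType) (X : I -> T -> R) : Prop :=
  forall (s : seq I) (A : I -> set R), uniq s ->
    (forall i, measurable (A i)) ->
    P (\bigcap_(i in [set` s]) X i @^-1` A i)
    = (\prod_(i <- s) P (X i @^-1` A i))%E.

Definition iid d (T : measurableType d) (R : realType) (P : probability T R)
    (X : nat -> T -> R) : Prop :=
  mutually_independent P (fun i : nat => X i.+1) /\
  (forall (i : nat) (A : set R), (0 < i)%N -> measurable A ->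
     P (X i @^-1` A) = P (X 1%N @^-1` A)).

(* Generating class of the sigma-algebra sigma(X_i, i >= 1). *)
Definition events_of (T : Type) (R : realType) (X : nat -> T -> R) :
    set (set T) :=
  [set C | exists i : nat, (0 < i)%N /\
             exists2 A : set R, measurable A & C = X i @^-1` A].

Definition independent_processes d (T : measurableType d) (R : realType)
    (P : probability T R) (X Y : nat -> T -> R) : Prop :=
  forall A B : set T, <<s events_of X >> A -> <<s events_of Y >> B ->
    P (A `&` B) = (P A * P B)%E.

(* k is a regular version of the conditional law of Y given <<s G >>. *)
Definition conditional_law d (T : measurableType d) (R : realType)
    (P : probability T R) (G : set (set T)) (Y : T -> R)
    (k : R.-pker (g_sigma_algebraType G) ~> R) : Prop :=
  forall (C : set T) (A : set R), <<s G >> C -> measurable A ->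
    (\int[P]_(w in C) k w A)%E = P (C `&` Y @^-1` A).

Definition cvg_in_probability d (T : measurableType d) (R : realType)
    (P : probability T R) (X : nat -> T -> R) (l : R) : Prop :=
  forall eps : R, 0 < eps ->
    P [set w | eps < `|X n w - l|] @[n --> \oo] --> 0%E.

(* The long-run variance of X is well defined and equal to v. *)
Definition has_long_run_variance d (T : measurableType d) (R : realType)
    (P : probability T R) (X : nat -> T -> R) (v : R) : Prop :=
  let gamma (k : nat) := fine (covariance P (X 1%N) (X k.+1)) in
  (forall i : nat, (0 < i)%N -> X i \in Lfun P 2%:E) /\
  gamma 0%N + 2 * (\sum_(1 <= k < n.+1) gamma k) @[n --> \oo] --> v.

(* The time set is [0, +oo[; the values B t for t < 0 are junk.
   normal_prob takes the standard deviation, and degenerates at 0. *)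
Definition standard_brownian_motion d (T : measurableType d) (R : realType)
    (P : probability T R) (B : R -> {RV P >-> R}) : Prop :=
  [/\ {ae P, forall w, B 0 w = 0},
      (forall s t : R, 0 <= s -> s < t ->
         forall A : set R, measurable A ->
         P [set w | A (B t w - B s w)] = normal_prob 0 (Num.sqrt (t - s)) A),
      (forall (m : nat) (t : nat -> R), 0 <= t 0%N ->
         (forall i, t i <= t i.+1) ->
         mutually_independent P (fun (i : 'I_m) w => B (t i.+1) w - B (t i) w))
    & {ae P, forall w, {within `[0, +oo[, continuous (fun t : R => B t w)}}].

(* Strong invariance principle with rate Delta for the partial sums of
   g(X_1), g(X_2), ...: the copy X' of X and the Brownian motion B live on a
   probability space that may differ from the one of X. *)
Definition strong_invariance d (T : measurableType d) (R : realType)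
    (P : probability T R) (X : nat -> {RV P >-> R}) (g : R -> R) (tau : R)
    (Delta : nat -> R) : Prop :=
  exists (d' : measure_display) (T' : measurableType d')
    (P' : probability T' R) (X' : nat -> {RV P' >-> R})
    (B : R -> {RV P' >-> R}),
  [/\ same_law P P' X X', standard_brownian_motion B
    & {ae P', forall w,
        (\big[Num.max/0]_(1 <= i < n.+1)
           `|\sum_(1 <= j < i.+1) g (X' j w) - tau * B i%:R w|) / Delta n
        @[n --> \oo] --> 0}].

Definition Delta (R : realType) (n : nat) : R :=
  n%:R `^ 4^-1 * ln n%:R.

(* sigma n i is sigma_i at sample size n. *)

Definition sum_pow (R : realType) (sigma : nat -> nat -> R) (p n : nat) : R :=
  \sum_(1 <= i < n.+1) sigma n i ^+ p.

(* r_n is variation_pow sigma 1 n and r_n^* is variation_pow sigma 2 n. *)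
Definition variation_pow (R : realType) (sigma : nat -> nat -> R)
    (p n : nat) : R :=
  `|sigma n n ^+ p|
  + \sum_(2 <= i < n.+1) `|sigma n i ^+ p - sigma n i.-1 ^+ p|.

Definition Sigma (R : realType) (sigma : nat -> nat -> R) (n : nat) : R :=
  Num.sqrt (sum_pow sigma 2 n).

(* The quantity written Sigma_n^{*2}. *)
Definition Sigma_star2 (R : realType) (sigma : nat -> nat -> R) (n : nat) : R :=
  Num.sqrt (sum_pow sigma 4 n).

Definition H (T : Type) (R : realType) (sigma : nat -> nat -> R)
    (e : nat -> T -> R) (n : nat) (w : T) : R :=
  (\sum_(1 <= i < n.+1) sigma n i * e i w)
  / Num.sqrt (\sum_(1 <= i < n.+1) sigma n i ^+ 2 * e i w ^+ 2).

Definition xi (T : Type) (R : realType) (sigma : nat -> nat -> R)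
    (e alpha : nat -> T -> R) (n i : nat) (w : T) : R :=
  sigma n i * e i w * alpha i w.

Definition xi_bar (T : Type) (R : realType) (sigma : nat -> nat -> R)
    (e alpha : nat -> T -> R) (n : nat) (w : T) : R :=
  (\sum_(1 <= i < n.+1) xi sigma e alpha n i w) / n%:R.

Definition H_star (T : Type) (R : realType) (sigma : nat -> nat -> R)
    (e alpha : nat -> T -> R) (n : nat) (w : T) : R :=
  (\sum_(1 <= i < n.+1) xi sigma e alpha n i w)
  / Num.sqrt (\sum_(1 <= i < n.+1)
                (xi sigma e alpha n i w - xi_bar sigma e alpha n w) ^+ 2).

(* Main.v *)
Require Import Defs.
From HB Require Import structures.
From mathcomp Require Import all_boot all_order all_algebra.
From mathcomp Require Import all_classical all_reals all_analysis.
From mathcomp Require Import measurable_realfun.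
From mathcomp Require Import ring lra.
Import Order.TTheory GRing.Theory Num.Theory.
Import numFieldNormedType.Exports.
Set Implicit Arguments.
Unset Strict Implicit.
Unset Printing Implicit Defensive.
Local Open Scope classical_set_scope.
Local Open Scope ring_scope.

(** The unconditional and the conditional law are both shown to converge to the
    standard normal law, the second one in probability; the limit being
    continuous, both distribution functions converge uniformly.

    The basic tool is Lyapunov's central limit theorem in a form that is uniform
    over probability spaces, numbers of terms and weights ([lyapunov_clt]). It is
    proved by Lindeberg's replacement with the normal distribution function [Phi]
    itself as test function: [Phi (y / v)] solves the heat equation in
    [(v ^+ 2, y)], so adding an independent centred summand of variance [s ^+ 2]
    to [y], or adding [s ^+ 2] to [v ^+ 2], changes its mean by the same amount up
    to an error of third order ([lindeberg_step]). Hence no Fourier analysis and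
    no Gaussian copies of the summands are needed.

    Observations. Summation by parts turns the uniform bound of the strong
    invariance principle into a bound on weighted sums with the variation of the
    weights as factor ([sip_error_pr]). On the space of the Brownian motion the
    numerator of [H] is thus a weighted sum of independent normal increments plus
    a negligible error, and the sum of squares in its denominator, divided by
    [Sigma ^+ 2], tends to one because the corresponding Brownian part has
    vanishing variance. Equality of the laws brings both facts back to the
    original space ([numerator_clt], [denominator_pr]), where Slutsky's theorem
    and the consistency of [tau_hat] give the limit of [H / tau_hat]
    ([studentized_clt]). The two Brownian motions may live on different spaces,
    since one of them only serves for a convergence in probability.

    Multipliers. For fixed weights [s_i], the self-normalized sum of the
    [s_i alpha_i] is asymptotically normal as soon as the sum of the [|s_i| ^+ 3]
    is small relative to the power 3/2 of the sum of the [s_i ^+ 2]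
    ([multiplier_clt]); under third moments only, its denominator is handled by
    truncation ([weighted_sqr_wlln]). With [s_i = sigma_i e_i] this smallness
    holds on an event that depends on the observations only and has probability
    close to one. By independence the observations can be frozen on every
    observable part of that event ([frozen_prob]), and this determines the
    conditional distribution function up to a small error and a negligible set
    ([kcdf_close], [conditional_clt]).

    Finally a finite grid suffices for the uniform distance ([polya_grid]), which
    is measurable by right continuity ([measurable_sup_distance]). *)

(** * Measurability of real-valued functions *)

Section real_measurability.
Context d (T : measurableType d) (R : realType).
Implicit Types f g : T -> R.

Lemma measurable_le_set f g : measurable_fun setT f -> measurable_fun setT g ->
  measurable [set w | f w <= g w].
Proof.
move=> mf mg; rewrite -[X in measurable X]setTI.
exact: (measurable_fun_ler mf mg measurableT (Y := [set true])).
Qed.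

Lemma measurable_lt_set f g : measurable_fun setT f -> measurable_fun setT g ->
  measurable [set w | f w < g w].
Proof.
move=> mf mg; rewrite -[X in measurable X]setTI.
exact: (measurable_fun_ltr mf mg measurableT (Y := [set true])).
Qed.

Lemma measurable_fun_sqrt f : measurable_fun setT f ->
  measurable_fun setT (fun w => Num.sqrt (f w)).
Proof.
move=> mf; apply: (measurableT_comp (f := @Num.sqrt R)) => //.
by apply: nondecreasing_measurable => // x y; exact: ler_wsqrtr.
Qed.

Lemma measurable_fun_inv f : measurable_fun setT f ->
  measurable_fun setT (fun w => (f w)^-1).
Proof.
move=> mf.
(* Inversion is discontinuous at 0: write it with a real power of a square. *)
apply: (eq_measurable_fun (fun w => f w * (f w ^+ 2) `^ (-1))).
  move=> w _; rewrite powR_inv1 ?sqr_ge0// expr2 invfM.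
  by have [->|f0] := eqVneq (f w) 0; rewrite ?invr0 ?mul0r// mulrA divff ?mul1r.
apply: measurable_funM => //.
apply: (measurableT_comp (f := (@powR R) ^~ (-1))) => //.
exact: measurable_funX.
Qed.

Lemma measurable_fun_div f g : measurable_fun setT f ->
  measurable_fun setT g -> measurable_fun setT (fun w => f w / g w).
Proof. by move=> mf /measurable_fun_inv; exact: measurable_funM. Qed.

Lemma measurable_fun_norm f : measurable_fun setT f ->
  measurable_fun setT (fun w => `|f w|).
Proof. by move=> mf; exact: measurableT_comp. Qed.

End real_measurability.

(** * Probabilities as real numbers *)

(** Real-valued, so that linear arithmetic applies to probabilities. *)
Definition pr d (T : measurableType d) (R : realType) (P : probability T R)
  (A : set T) : R := fine (P A).

Section pr.
Context d (T : measurableType d) (R : realType) (P : probability T R).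
Implicit Types A B : set T.

Lemma prK A : measurable A -> (pr P A)%:E = P A.
Proof. by move=> mA; rewrite /pr fineK// fin_num_measure. Qed.

Lemma pr_ge0 A : 0 <= pr P A.
Proof. by rewrite /pr fine_ge0. Qed.

Lemma pr_le A B : measurable A -> measurable B -> A `<=` B ->
  pr P A <= pr P B.
Proof.
move=> mA mB AB; rewrite /pr fine_le ?fin_num_measure//.
by rewrite le_measure ?inE.
Qed.

Lemma pr_le1 A : measurable A -> pr P A <= 1.
Proof. by move=> mA; rewrite -lee_fin prK// probability_le1. Qed.

Lemma pr_leU A B C : measurable A -> measurable B -> measurable C ->
  A `<=` B `|` C -> pr P A <= pr P B + pr P C.
Proof.
move=> mA mB mC ABC; rewrite -lee_fin EFinD !prK//.
apply: le_trans (measureU2 _ mB mC); rewrite le_measure ?inE//.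
exact: measurableU.
Qed.

End pr.

(** * Integrals over a probability space *)

Notation integ P X := (P.-integrable [set: _] (EFin \o X)).

Section integ.
Context d (T : measurableType d) (R : realType) (P : probability T R).
Implicit Types X Y : T -> R.

Lemma integP X : measurable_fun setT X ->
  (\int[P]_w (`|X w|)%:E < +oo)%E -> integ P X.
Proof.
by move=> mX fX; apply/integrableP; split => //; exact/measurable_EFinP.
Qed.

Lemma integ_measurable X : integ P X -> measurable_fun setT X.
Proof. by move/measurable_int/measurable_EFinP. Qed.

Lemma integ_le X Y : measurable_fun setT X -> integ P Y ->
  (forall w, `|X w| <= `|Y w|) -> integ P X.
Proof.
move=> mX iY XY; apply: le_integrable iY => //.
- exact/measurable_EFinP.
- by move=> w _ /=; rewrite lee_fin.
Qed.

Lemma integ_cst (c : R) : integ P (fun _ => c).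
Proof. exact: finite_measure_integrable_cst. Qed.

Lemma integ_bounded X M : measurable_fun setT X ->
  (forall w, `|X w| <= M) -> integ P X.
Proof.
move=> mX XM; apply: (integ_le mX (integ_cst M)) => w.
exact: le_trans (XM w) (ler_norm _).
Qed.

Lemma integD X Y : integ P X -> integ P Y -> integ P (fun w => X w + Y w).
Proof. by move=> iX iY; exact: (integrableD measurableT iX iY). Qed.

Lemma integB X Y : integ P X -> integ P Y -> integ P (fun w => X w - Y w).
Proof. by move=> iX iY; exact: (integrableB measurableT iX iY). Qed.

Lemma integZ k X : integ P X -> integ P (fun w => k * X w).
Proof. by move=> iX; exact: (integrableZl measurableT k iX). Qed.

Lemma integ_sum (I : Type) (s : seq I) (X : I -> T -> R) :
  (forall i, integ P (X i)) -> integ P (fun w => \sum_(i <- s) X i w).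
Proof.
move=> iX; elim: s => [|i s IH].
  by under [X in EFin \o X]funext do rewrite big_nil; exact: integ_cst.
by under [X in EFin \o X]funext do rewrite big_cons; exact: integD.
Qed.

Lemma Rintegral_cst_prob (c : R) : \int[P]_w c = c.
Proof.
rewrite /Rintegral integral_cst//= [X in (_ * X)%E](_ : _
  = 1%E) ?mule1//. exact: probability_setT.
Qed.

Lemma Rintegral_sum_prob (I : Type) (s : seq I) (X : I -> T -> R) :
  (forall i, integ P (X i)) ->
  \int[P]_w (\sum_(i <- s) X i w) = \sum_(i <- s) \int[P]_w X i w.
Proof.
move=> iX; elim: s => [|i s IH].
  by under eq_Rintegral do rewrite big_nil; rewrite big_nil Rintegral_cst_prob.
under eq_Rintegral do rewrite big_cons.
by rewrite RintegralD ?big_cons ?IH//; exact: integ_sum.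
Qed.

Lemma Rintegral_le X Y : integ P X -> integ P Y ->
  (forall w, X w <= Y w) -> \int[P]_w X w <= \int[P]_w Y w.
Proof. by move=> iX iY XY; exact: le_Rintegral. Qed.

Lemma norm_Rintegral_le X Y : integ P X -> integ P Y ->
  (forall w, `|X w| <= Y w) -> `|\int[P]_w X w| <= \int[P]_w Y w.
Proof.
move=> iX iY XY; apply: le_trans (le_normr_Rintegral _ _) _ => //.
apply: Rintegral_le => //; apply: (integ_le _ iX) => [|w].
  exact: measurable_fun_norm (integ_measurable iX).
by rewrite normr_id.
Qed.

Lemma Rintegral_indic A : measurable A -> \int[P]_w (\1_A w) = pr P A.
Proof. by move=> mA; rewrite /Rintegral/= integral_indic// setIT. Qed.

Lemma integ_indic A : measurable A -> integ P (\1_A : T -> R).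
Proof. by move=> mA; apply: integrable_indic; rewrite // ltey_eq fin_num_measure. Qed.

Lemma pr_markov X (a : R) : integ P X -> (forall w, 0 <= X w) ->
  0 < a -> pr P [set w | a <= X w] <= a^-1 * \int[P]_w X w.
Proof.
move=> iX X0 a0; have mA : measurable [set w | a <= X w].
  by apply: measurable_le_set => //; exact: integ_measurable.
rewrite mulrC ler_pdivlMr// mulrC -Rintegral_indic// -RintegralZl//;
  last exact: integ_indic.
apply: Rintegral_le => // [|w]; first by apply: integZ; exact: integ_indic.
rewrite indicE; case: (boolP (w \in _)) => [|_]; last by rewrite mulr0.
by rewrite inE/= mulr1.
Qed.

Lemma pr_chebyshev X (a : R) : measurable_fun setT X -> integ P (fun w => X w ^+ 2) ->
  0 < a -> pr P [set w | a < `|X w|] <= (a ^+ 2)^-1 * \int[P]_w (X w ^+ 2).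
Proof.
move=> mX iX a0; apply: le_trans (pr_markov iX _ (exprn_gt0 2 a0)); last first.
  by move=> w; exact: sqr_ge0.
apply: pr_le.
- by apply: measurable_lt_set => //; exact: measurable_fun_norm.
- by apply: measurable_le_set => //; exact: integ_measurable.
- move=> w /= aX; rewrite -(real_normK (num_real (X w))).
  by rewrite ler_pXn2r ?nnegrE ?normr_ge0 ?(ltW a0) ?(ltW aX).
Qed.

End integ.

(** * Independence *)

Definition indep2 d d1 d2 (T : measurableType d) (T1 : measurableType d1)
  (T2 : measurableType d2) (R : realType) (P : probability T R)
  (f : T -> T1) (g : T -> T2) :=
  forall A B, measurable A -> measurable B ->
    P (f @^-1` A `&` g @^-1` B) = (P (f @^-1` A) * P (g @^-1` B))%E.

Lemma indep2_comp d (T : measurableType d) (R : realType) (P : probability T R)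
    d1 d2 d1' d2' (T1 : measurableType d1) (T2 : measurableType d2)
    (T1' : measurableType d1') (T2' : measurableType d2')
    (f : T -> T1) (g : T -> T2) (h : T1 -> T1') (k : T2 -> T2') :
  measurable_fun setT h -> measurable_fun setT k ->
  indep2 P f g -> indep2 P (fun w => h (f w)) (fun w => k (g w)).
Proof.
move=> mh mk fg A B mA mB; have := fg (h @^-1` A) (k @^-1` B); apply.
- by rewrite -[X in measurable X]setTI; exact: mh.
- by rewrite -[X in measurable X]setTI; exact: mk.
Qed.

Section indep2_product.
Context d d1 d2 (T : measurableType d) (T1 : measurableType d1)
  (T2 : measurableType d2) (R : realType) (P : probability T R).

(** A joint law that factorizes on rectangles is the product measure, because
    rectangles determine a measure on the product. *)
Lemma indep2_joint_law (f : {mfun T >-> T1}) (g : {mfun T >-> T2}) :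
  indep2 P f g -> forall E : set (T1 * T2), measurable E ->
  P [set w | E (f w, g w)] = (distribution P f \x distribution P g)%E E.
Proof.
move=> fg E mE.
have mfg : measurable_fun setT (fun w => (f w, g w)).
  exact: measurable_fun_pair.
pose h : {mfun T >-> (T1 * T2)%type} := mfun_Sub (mem_set mfg).
rewrite (@product_measure_unique _ _ _ _ _ _ _ (distribution P h))//.
Qed.

End indep2_product.

Section indep2_expectation.
Context d (T : measurableType d) (R : realType) (P : probability T R).
Variables X Y : T -> R.
Hypotheses (iX : integ P X) (iY : integ P Y) (XY : indep2 P X Y).

Let X' : {mfun T >-> R} := mfun_Sub (mem_set (integ_measurable iX)).
Let Y' : {mfun T >-> R} := mfun_Sub (mem_set (integ_measurable iY)).

Let mXY : measurable_fun setT (fun w => (X' w, Y' w)).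
Proof. exact: measurable_fun_pair. Qed.

Let XY' : {mfun T >-> (R * R)%type} := mfun_Sub (mem_set mXY).

Let mul2 (z : R * R) : \bar R := (z.1 * z.2)%:E.

Let measurable_mul2 : measurable_fun setT mul2.
Proof.
apply/measurable_EFinP; apply: measurable_funM.
  exact: measurable_fst.
exact: measurable_snd.
Qed.

Let integrable_mul2 :
  (distribution P X' \x distribution P Y')%E.-integrable setT mul2.
Proof.
apply/(integrable12ltyP _ _ measurable_mul2).
have -> : (fun x : R => \int[distribution P Y']_y `|mul2 (x, y)|)%E =
    (fun x => `|x|%:E * \int[distribution P Y']_y `|y|%:E)%E.
  apply/funext => x; rewrite -ge0_integralZl//.
  - by apply: eq_integral => y _; rewrite /mul2/= -EFinM -normrM.
  - exact/measurable_EFinP/measurable_fun_norm.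
rewrite ge0_integralZr//.
- rewrite ge0_integral_distribution//=; last first.
    exact/measurable_EFinP/measurable_fun_norm.
  rewrite ge0_integral_distribution//=; last first.
    exact/measurable_EFinP/measurable_fun_norm.
  move/integrableP : iX => [_ iX']; move/integrableP : iY => [_ iY'].
  by apply: lte_mul_pinfty => //; rewrite ?ge0_fin_numE//; exact: integral_ge0.
- exact/measurable_EFinP/measurable_fun_norm.
- by apply: integral_ge0 => y _; rewrite lee_fin.
Qed.

Let law_eq (E : set (R * R)) : measurable E -> E `<=` setT ->
  distribution P XY' E = (distribution P X' \x distribution P Y')%E E.
Proof. by move=> mE _; exact: (@indep2_joint_law _ _ _ _ _ _ _ _ X' Y'). Qed.

Lemma indep2_integM : integ P (fun w => X w * Y w).
Proof.
apply: integP.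
  by apply: measurable_funM; [exact: (integ_measurable iX)|
    exact: (integ_measurable iY)].
have /integrableP[_] := integrable_mul2.
rewrite -(eq_measure_integral _ law_eq) ge0_integral_distribution//.
exact: (measurableT_comp (f := abse)).
Qed.

(** The expectation of a product of independent variables: Fubini for the
    product of their laws. *)
Lemma indep2_RintegralM :
  \int[P]_w (X w * Y w) = (\int[P]_w X w) * (\int[P]_w Y w).
Proof.
rewrite /Rintegral -fineM; [|exact: integrable_fin_num..].
congr fine.
rewrite -(@integral_distribution _ _ _ _ _ _ XY' mul2)//; last exact: indep2_integM.
rewrite (eq_measure_integral _ law_eq) -integral12_prod_meas1//.
transitivity (\int[distribution P X']_x (x%:E * \int[P]_w (Y w)%:E))%E.
  apply: eq_integral => x _.
  rewrite /fubini_F/mul2/=.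
  rewrite -(@integral_distribution _ _ _ _ _ _ Y' EFin)//.
  rewrite -integralZl//.
  by apply: integrable_pushforward => //; exact: iY.
rewrite -(fineK (integrable_fin_num measurableT iY)) integralZr//.
  by rewrite integral_distribution.
by apply: integrable_pushforward => //; exact: iX.
Qed.

End indep2_expectation.

Section mutual_independence.
Context d (T : measurableType d) (R : realType) (P : probability T R).
Variables (X : nat -> T -> R) (n : nat).
Hypothesis mX : forall i, measurable_fun setT (X i).
Hypothesis indX : mutually_independent P (fun i : 'I_n => X i).

Let mpre i (A : set R) : measurable A -> measurable (X i @^-1` A).
Proof. by move=> mA; rewrite -[X in measurable X]setTI; exact: mX. Qed.

Lemma mutually_independent_prefix (A : nat -> set R) m : (m <= n)%N ->
  (forall i, measurable (A i)) ->
  P (\big[setI/setT]_(i < m) (X i @^-1` A i))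
  = (\prod_(i < m) P (X i @^-1` A i))%E.
Proof.
move=> mn mA.
have := indX (s := [seq widen_ord mn i | i <- enum 'I_m])
  (A := fun i : 'I_n => A i) _ (fun i => mA i).
rewrite big_map big_enum /= => <-; last first.
  rewrite map_inj_uniq ?enum_uniq// => i j /(congr1 val)/= ij; exact: val_inj.
congr (P _); rewrite -(bigcap_mkord m (fun i => X i @^-1` A i)).
apply/seteqP; split=> [w Aw i /= /mapP[j _ ->]|w Aw i /= im].
  exact: (Aw j (ltn_ord j)).
apply: (Aw (widen_ord mn (Ordinal im))) => /=.
by apply: map_f; rewrite mem_enum.
Qed.

Let past k : set (set T) := [set C | exists A : nat -> set R,
  (forall i, measurable (A i)) /\ C = \big[setI/setT]_(i < k) (X i @^-1` A i)].

Let past_measurable k : past k `<=` measurable.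
Proof. by move=> _ [A [mA ->]]; apply: bigsetI_measurable => i _; exact: mpre. Qed.

Let past_setI k : setI_closed (past k).
Proof.
move=> _ _ [A [mA ->]] [B [mB ->]].
exists (fun i => A i `&` B i); split; first by move=> i; exact: measurableI.
by rewrite -big_split/=.
Qed.

(** Both sides, as functions of [C], are finite measures that agree on the
    intersections [X_0 in A_0, ..., X_(k-1) in A_(k-1)], a class stable under
    intersection that generates the past. *)
Let past_indep k (B : set R) : (k < n)%N -> measurable B ->
  forall C, <<s past k >> C ->
  P (C `&` X k @^-1` B) = (P C * P (X k @^-1` B))%E.
Proof.
move=> kn mB; set D := X k @^-1` B; have mD : measurable D by exact: mpre.
pose r : {nonneg R} := NngNum (pr_ge0 P D).
have PD : P D = (r%:num)%:E by rewrite -prK.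
suff E C : <<s past k >> C -> mrestr P mD C = mscale r P C.
  by move=> C /E; rewrite /mrestr /mscale => ->; rewrite PD muleC.
have pT : past k setT.
  by exists (fun=> setT); split => //; rewrite big1// => i _; rewrite preimage_setT.
apply: (g_sigma_algebra_measure_unique (past k) (@past_measurable k)
  (fun=> setT) (fun=> pT)) => //.
- by apply/seteqP; split => // w _; exists 0%N.
- move=> _ [A [mA ->]]; change (P (\big[setI/setT]_(i < k) (X i @^-1` A i) `&` D) =
    ((r%:num)%:E * P (\big[setI/setT]_(i < k) (X i @^-1` A i)))%E).
  rewrite -PD /D.
  have := @mutually_independent_prefix
    (fun i => if i == k then B else A i) k.+1 kn _.
  rewrite !big_ord_recr /= eqxx.
  have ik (i : 'I_k) : (i == k :> nat) = false by rewrite ltn_eqF.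
  under eq_bigr do rewrite ik; under [in RHS]eq_bigr do rewrite ik.
  move=> ->; last by move=> i; case: ifP.
  by rewrite mutually_independent_prefix// 1?ltnW// muleC.
- by move=> _; rewrite /= /mrestr setTI ltey_eq fin_num_measure.
Qed.

Definition wsum (a : nat -> R) (k : nat) (w : T) := \sum_(i < k) a i * X i w.

Lemma measurable_wsum a k : measurable_fun setT (wsum a k).
Proof. by apply: measurable_sum => i; exact: measurable_funM. Qed.

(** A partial sum is measurable for the sigma-algebra generated by the past,
    which is independent of the next term. *)
Lemma indep2_wsum a k : (k < n)%N -> indep2 P (wsum a k) (X k).
Proof.
move=> kn A B mA mB; apply: past_indep => //.
have mXk (i : 'I_k) : measurable_fun (setT : set (g_sigma_algebraType (past k)))
    (X i).
  move=> _ Y mY; rewrite setTI; apply: sub_sigma_algebra.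
  exists (fun j : nat => if j == i :> nat then Y else setT); split.
    by move=> j; case: ifP.
  rewrite (bigD1 i)//= eqxx big1 ?setIT// => j ji.
  by rewrite ifN ?preimage_setT.
have mS : measurable_fun (setT : set (g_sigma_algebraType (past k))) (wsum a k).
  by apply: measurable_sum => i; apply: measurable_funM => //; exact: mXk.
by have := mS measurableT _ mA; rewrite setTI.
Qed.

Lemma integ_of_sqr (Y : T -> R) : measurable_fun setT Y ->
  integ P (fun w => Y w ^+ 2) -> integ P Y.
Proof.
move=> mY iY; apply: (integ_le mY (integD (integ_cst P 1) iY)) => w.
rewrite [leRHS]ger0_norm ?addr_ge0 ?sqr_ge0//.
rewrite -(real_normK (num_real (Y w))).
by have := sqr_ge0 (`|Y w| - 2^-1); nra.
Qed.

Hypothesis iX2 : forall i, (i < n)%N -> integ P (fun w => X i w ^+ 2).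
Hypothesis EX0 : forall i, (i < n)%N -> \int[P]_w X i w = 0.

(** The variance of a sum of independent centred variables is the sum of the
    variances: the cross terms integrate to zero. *)
Lemma second_moment_wsum (a : nat -> R) k : (k <= n)%N ->
  integ P (fun w => wsum a k w ^+ 2) /\
  \int[P]_w (wsum a k w ^+ 2) = \sum_(i < k) a i ^+ 2 * \int[P]_w (X i w ^+ 2).
Proof.
elim: k => [_|k IH kn].
  rewrite big_ord0.
  under eq_fun do rewrite /wsum big_ord0 expr0n/=.
  by split; [exact: integ_cst|exact: Rintegral_cst_prob].
have [iS ES] := IH (ltnW kn).
have iSk : integ P (wsum a k) by apply: integ_of_sqr => //; exact: measurable_wsum.
have iXk : integ P (X k) by apply: integ_of_sqr => //; exact: iX2.
have ind := @indep2_wsum a k kn.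
have iSX := indep2_integM iSk iXk ind.
have sqrE w : wsum a k.+1 w ^+ 2 = wsum a k w ^+ 2
    + (2 * a k * (wsum a k w * X k w) + a k ^+ 2 * (X k w ^+ 2)).
  by rewrite /wsum big_ord_recr/=; ring.
have i1 := integZ (2 * a k) iSX.
have i2 := integZ (a k ^+ 2) (iX2 kn).
have i3 := integD i1 i2.
under eq_fun do rewrite sqrE.
split; first exact: integD.
rewrite RintegralD// RintegralD// RintegralZl// RintegralZl//; last exact: iX2.
by rewrite indep2_RintegralM// EX0// mulr0 mulr0 add0r big_ord_recr/= ES.
Qed.

End mutual_independence.

Lemma mutually_independent_comp d (T : measurableType d) (R : realType)
    (P : probability T R) (I : eqType) (X : I -> T -> R) (f : I -> R -> R) :
  (forall i, measurable_fun setT (f i)) -> mutually_independent P X ->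
  mutually_independent P (fun i w => f i (X i w)).
Proof.
move=> mf ind s A us mA.
apply: (ind s (fun i => f i @^-1` A i)) => // i.
by rewrite -[X in measurable X]setTI; exact: mf.
Qed.

(** * Taylor estimates from the mean value theorem *)

Section calculus.
Context (R : realType).
Implicit Types (f g : R -> R) (x a b c : R).

Lemma derive_add f g x a b : is_derive x 1 f a -> is_derive x 1 g b ->
  is_derive x 1 (fun t => f t + g t) (a + b).
Proof. by move=> df dg; exact: is_deriveD. Qed.

Lemma derive_sub f g x a b : is_derive x 1 f a -> is_derive x 1 g b ->
  is_derive x 1 (fun t => f t - g t) (a - b).
Proof. by move=> df dg; exact: is_deriveB. Qed.

Lemma derive_mul f g x a b : is_derive x 1 f a -> is_derive x 1 g b ->
  is_derive x 1 (fun t => f t * g t) (f x * b + g x * a).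
Proof. by move=> df dg; exact: is_deriveM. Qed.

Lemma derive_cst c x : is_derive x 1 (fun _ : R => c) 0.
Proof. exact: is_derive_cst. Qed.

Lemma derive_idr x : is_derive x 1 (fun t : R => t) 1.
Proof. exact: is_derive_id. Qed.

Lemma derive_scale f x a c : is_derive x 1 f a ->
  is_derive x 1 (fun t => c * f t) (c * a).
Proof.
move=> df; apply: is_derive_eq (derive_mul (derive_cst c x) df) _.
by rewrite mulr0 addr0.
Qed.

Lemma derive_comp f g x a b : is_derive (g x) 1 f a -> is_derive x 1 g b ->
  is_derive x 1 (fun t => f (g t)) (a * b).
Proof. by move=> df dg; exact: is_derive1_comp. Qed.

Lemma derive_sqr f x a : is_derive x 1 f a ->
  is_derive x 1 (fun t => f t ^+ 2) (2 * f x * a).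
Proof.
move=> df; have := derive_mul df df.
under eq_fun do rewrite -expr2.
by move/is_derive_eq; apply; ring.
Qed.

Definition between a b x := (a <= x <= b) || (b <= x <= a).

Lemma between_left a b : between a b a.
Proof. by rewrite /between lexx/= andbT le_total. Qed.

Lemma between_trans a b c x : between a b c -> between a c x -> between a b x.
Proof.
by move=> /orP[]/andP[? ?] /orP[]/andP[? ?]; apply/orP; (left + right); apply/andP;
  split; lra.
Qed.

Lemma between_norm a b x : between a b x -> `|x - a| <= `|b - a|.
Proof.
move=> /orP[]/andP[? ?]; first by rewrite !ger0_norm; lra.
by rewrite !ler0_norm; lra.
Qed.

Lemma mvt_bound f (df : R -> R) a b (K : R) :
  (forall t, between a b t -> is_derive t 1 f (df t)) ->
  (forall t, between a b t -> `|df t| <= K) ->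
  `|f b - f a| <= K * `|b - a|.
Proof.
move=> dfP dfK.
wlog ab : a b dfP dfK / a <= b => [H|].
  have [/H|/ltW ba] := leP a b; first exact.
  rewrite distrC (distrC b a); apply: H => // t; rewrite /between orbC => tba;
    [exact: dfP|exact: dfK].
have absP t : t \in `[a, b] -> between a b t.
  by rewrite in_itv/= /between => ->.
have [| |c /absP cab ->] := @MVT_segment R f df a b ab.
- move=> t tab; apply: dfP; apply: absP.
  by apply: subset_itv_oo_cc.
- apply: derivable_within_continuous => t tab.
  exact: (@ex_derive _ _ _ _ _ _ _ (dfP _ (absP _ tab))).
- by rewrite normrM ler_wpM2r// dfK.
Qed.

(** The constants here and below are not optimal: the remainder has the
    remainder of the previous order as its derivative, and [mvt_bound] is applied
    to it without integrating the powers of [t - a]. *)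
Lemma taylor2_bound f df ddf a b (K : R) :
  (forall t, between a b t -> is_derive t 1 f (df t)) ->
  (forall t, between a b t -> is_derive t 1 df (ddf t)) ->
  (forall t, between a b t -> `|ddf t| <= K) ->
  `|f b - f a - (b - a) * df a| <= K * `|b - a| ^+ 2.
Proof.
move=> f1 f2 fK.
have K0 : 0 <= K by apply: le_trans (fK a _) => //; exact: between_left.
pose g t := f t - t * df a.
rewrite (_ : f b - f a - (b - a) * df a = g b - g a); last by rewrite /g; ring.
rewrite expr2 mulrA; apply: (@mvt_bound g (fun t => df t - df a)) => t tab.
  apply: is_derive_eq (derive_sub (f1 t tab) (derive_mul (derive_idr t) (derive_cst (df a) t))) _.
  by rewrite mulr0 add0r mulr1.
apply: le_trans (_ : K * `|t - a| <= _); last first.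
  by apply: ler_wpM2l => //; exact: between_norm.
by apply: (@mvt_bound df ddf) => s sta; [apply: f2|apply: fK];
  exact: between_trans tab _.
Qed.

Lemma taylor3_bound f df ddf dddf a b (K : R) :
  (forall t, between a b t -> is_derive t 1 f (df t)) ->
  (forall t, between a b t -> is_derive t 1 df (ddf t)) ->
  (forall t, between a b t -> is_derive t 1 ddf (dddf t)) ->
  (forall t, between a b t -> `|dddf t| <= K) ->
  `|f b - f a - (b - a) * df a - (b - a) ^+ 2 / 2 * ddf a| <= K * `|b - a| ^+ 3.
Proof.
move=> f1 f2 f3 fK.
have K0 : 0 <= K by apply: le_trans (fK a _) => //; exact: between_left.
pose g t := f t - (t * df a + (t - a) ^+ 2 * (ddf a / 2)).
rewrite (_ : f b - _ - _ - _ = g b - g a);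
  last by rewrite /g subrr expr0n/= mul0r; field.
rewrite exprS mulrCA mulrC.
apply: (@mvt_bound g (fun t => df t - df a - (t - a) * ddf a)) => t tab.
  apply: is_derive_eq (derive_sub (f1 t tab) (derive_add
    (derive_mul (derive_idr t) (derive_cst (df a) t))
    (derive_mul (derive_sqr (derive_sub (derive_idr t) (derive_cst a t)))
      (derive_cst (ddf a / 2) t)))) _.
  by field.
apply: le_trans (_ : K * `|t - a| ^+ 2 <= _); last first.
  by apply: ler_wpM2l => //; rewrite ler_pXn2r ?nnegrE ?between_norm.
by apply: (@taylor2_bound df ddf dddf) => s sta; [apply: f2|apply: f3|apply: fK];
  exact: between_trans tab _.
Qed.

End calculus.

(** * The standard normal distribution *)

Section normal.
Context (R : realType).
Implicit Types x y z v s h : R.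
Local Notation mu := (@lebesgue_measure R).

Definition phi x : R := normal_pdf 0 1 x.

Definition Phi x : R := \int[mu]_(t in `]-oo, x]) phi t.

Lemma phiE x : phi x = normal_peak (1 : R) * expR (- (x ^+ 2 / 2)).
Proof.
by rewrite /phi normal_pdfE ?oner_neq0// /normal_fun subr0 expr1n mulNr.
Qed.

Lemma phi_ge0 x : 0 <= phi x.
Proof. exact: normal_pdf_ge0. Qed.

Lemma normal_peak_le1 : normal_peak (1 : R) <= 1.
Proof.
rewrite /normal_peak invf_le1 ?sqrtr_gt0 ?mulrn_wgt0 ?mulr_gt0 ?pi_gt0//.
rewrite -[leLHS]sqrtr1 ler_wsqrtr// expr1n mul1r -mulr_natr.
by have := pi_ge2 R; lra.
Qed.

Lemma phiN x : phi (- x) = phi x.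
Proof. by rewrite !phiE sqrrN. Qed.

Lemma phi_le1 x : phi x <= 1.
Proof.
apply: le_trans normal_peak_le1; apply: normal_pdf_ub; exact: oner_neq0.
Qed.

Lemma continuous_phi : continuous phi.
Proof. by apply: continuous_normal_pdf; exact: oner_neq0. Qed.

Lemma measurable_phi : measurable_fun setT phi.
Proof. exact: measurable_normal_pdf. Qed.

Lemma integrable_phi A : measurable A -> mu.-integrable A (EFin \o phi).
Proof.
by move=> mA; apply: (integrableS measurableT) => //; exact: integrable_normal_pdf.
Qed.

Lemma is_derive_Phi x : is_derive x 1 Phi (phi x).
Proof.
have x1 : x < x + 1 by rewrite ltrDl.
have [d1 d2] := @continuous_FTC1 R phi -oo%O x (x + 1) x1
  (integrable_phi (measurable_itv _)) (ltNyr x) (@continuous_phi x).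
by apply: DeriveDef; [exact: d1|rewrite -derive1E; exact: d2].
Qed.

Lemma is_derive_phi x : is_derive x 1 phi (- (x * phi x)).
Proof.
have -> : phi = fun t => normal_peak (1 : R) * expR (- 2^-1 * t ^+ 2).
  by apply/funext => t; rewrite phiE; congr (_ * expR _); field.
apply: is_derive_eq (derive_scale _ (@derive_comp _ expR _ _ _ _ (is_derive_expR _)
  (derive_scale _ (derive_sqr (derive_idr x))))) _.
by field.
Qed.

Lemma is_derive_phi' x : is_derive x 1 (fun t => - (t * phi t)) ((x ^+ 2 - 1) * phi x).
Proof.
have -> : (fun t : R => - (t * phi t)) = (fun t => -1 * (t * phi t)).
  by apply/funext => t; rewrite mulN1r.
apply: is_derive_eq (derive_scale _ (derive_mul (derive_idr x) (is_derive_phi x))) _.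
by ring.
Qed.

Lemma sqr_phi_le x : x ^+ 2 * phi x <= 2.
Proof.
rewrite phiE mulrCA; apply: (@le_trans _ _ (1 * 2)); last by rewrite mul1r.
apply: ler_pM; rewrite ?normal_peak_ge0 ?normal_peak_le1//.
  by rewrite mulr_ge0 ?sqr_ge0 ?expR_ge0.
rewrite expRN ler_pdivrMr ?expR_gt0//.
by have := expR_ge1Dx (x ^+ 2 / 2); lra.
Qed.

Lemma pow4_phi_le x : x ^+ 4 * phi x <= 16.
Proof.
rewrite phiE mulrCA; apply: (@le_trans _ _ (1 * 16)); last by rewrite mul1r.
apply: ler_pM; rewrite ?normal_peak_ge0 ?normal_peak_le1//.
  by rewrite mulr_ge0 ?expR_ge0// exprn_even_ge0.
rewrite expRN ler_pdivrMr ?expR_gt0//.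
have -> : x ^+ 2 / 2 = x ^+ 2 / 4 + x ^+ 2 / 4 by field.
rewrite expRD.
have := expR_ge1Dx (x ^+ 2 / 4).
have : 0 <= x ^+ 2 by exact: sqr_ge0.
rewrite (_ : x ^+ 4 = x ^+ 2 * x ^+ 2); last by ring.
by set u := x ^+ 2; set e := expR _; nra.
Qed.

Lemma norm_x_phi_le x : `|x * phi x| <= 3 / 2.
Proof.
rewrite normrM (ger0_norm (phi_ge0 x)).
have := sqr_phi_le x; have := phi_le1 x; have := phi_ge0 x.
rewrite -(real_normK (num_real x)).
have : 0 <= (`|x| - 1) ^+ 2 by exact: sqr_ge0.
by set u := `|x|; set p := phi x; nra.
Qed.

(** The second derivative of [u |-> Phi (y / u)] is [u^-1 ^+ 2] times this
    expression at [x = y / u]. *)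
Lemma norm_x3_phi_le x : `|(2 * x - x ^+ 3) * phi x| <= 12.
Proof.
rewrite normrM (ger0_norm (phi_ge0 x)).
apply: (@le_trans _ _ ((2 * `|x| + `|x| ^+ 3) * phi x)).
  apply: ler_wpM2r; first exact: phi_ge0.
  apply: le_trans (ler_normB _ _) _.
  by rewrite normrM normrX ger0_norm.
have := sqr_phi_le x; have := phi_le1 x; have := phi_ge0 x.
have := pow4_phi_le x.
rewrite (_ : x ^+ 4 = (x ^+ 2) ^+ 2); last by ring.
rewrite -(real_normK (num_real x)).
have : 0 <= (`|x| - 1) ^+ 2 by exact: sqr_ge0.
have : 0 <= `|x| by [].
set u := `|x|; set p := phi x => u0 u1 h4 p0 p1 h2.
have : 2 * u + u ^+ 3 <= 1 + 3 / 2 * u ^+ 2 + (u ^+ 2) ^+ 2 / 2 by nra.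
by move=> /(ler_wpM2r p0); lra.
Qed.

Lemma derive_inv x : x != 0 -> is_derive x 1 (fun t => t^-1) (- x^-1 ^+ 2).
Proof.
move=> x0; apply: is_derive_eq (is_deriveV x0 (derive_idr x)) _.
by rewrite /GRing.scale/= mulr1 exprVn.
Qed.

Lemma Phi_taylor3 x y :
  `|Phi y - Phi x - (y - x) * phi x - (y - x) ^+ 2 / 2 * - (x * phi x)|
    <= 3 * `|y - x| ^+ 3.
Proof.
apply: (@taylor3_bound R Phi phi (fun t => - (t * phi t))
  (fun t => (t ^+ 2 - 1) * phi t)) => t _.
- exact: is_derive_Phi.
- exact: is_derive_phi.
- exact: is_derive_phi'.
rewrite normrM (ger0_norm (phi_ge0 t)).
have := sqr_phi_le t; have := phi_le1 t; have := phi_ge0 t.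
have h : `|t ^+ 2 - 1| <= t ^+ 2 + 1.
  by apply: le_trans (ler_normB _ _) _; rewrite normr1 ger0_norm ?sqr_ge0.
move=> p0 p1 p2; have := ler_wpM2r p0 h; lra.
Qed.

(** First-order expansion of [Phi (y / v)] in the scale [v]; with
    [v' ^+ 2 = v ^+ 2 + s ^+ 2] its main term is the second-order term of the
    expansion in space, because [Phi (y / v)] solves the heat equation in the
    variables [(v ^+ 2, y)]. *)
Lemma Phi_scale_taylor y v v' s : 0 < v -> v <= v' ->
  v' ^+ 2 = v ^+ 2 + s ^+ 2 ->
  `|Phi (y / v') - Phi (y / v) - s ^+ 2 / (2 * v ^+ 2) * - (y / v * phi (y / v))|
    <= 4 * (s ^+ 4 / v ^+ 4).
Proof.
move=> v0 vv' vs; have vn0 : v != 0 by rewrite gt_eqF.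
pose h' u := - (y * (u^-1 ^+ 2 * phi (y * u^-1))).
pose h'' u := u^-1 ^+ 2 * ((2 * (y / u) - (y / u) ^+ 3) * phi (y / u)).
have D0 : 0 <= v' - v by rewrite subr_ge0.
have h1 t : between v v' t -> v <= t.
  by move=> /orP[]/andP[? ?] //; lra.
have t_neq0 t : between v v' t -> t != 0.
  by move=> /h1 vt; rewrite gt_eqF// (lt_le_trans v0).
have dPhi t : between v v' t -> is_derive t 1 (fun u => Phi (y / u)) (h' t).
  move=> /t_neq0 t0.
  apply: is_derive_eq (@derive_comp _ Phi (fun u => y / u) t _ _ (is_derive_Phi _)
    (derive_scale y (derive_inv t0))) _.
  by rewrite /h'; ring.
have dh' t : between v v' t -> is_derive t 1 h' (h'' t).
  move=> /t_neq0 t0.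
  have dphi := @derive_comp _ phi (fun u => y / u) t _ _ (is_derive_phi _)
    (derive_scale y (derive_inv t0)).
  have -> : h' = (fun u => - y * (u^-1 ^+ 2 * phi (y / u))).
    by apply/funext => u; rewrite /h' mulNr.
  apply: is_derive_eq (derive_scale (- y) (derive_mul
    (derive_sqr (derive_inv t0)) dphi)) _.
  by rewrite /h''; field.
have h''K t : between v v' t -> `|h'' t| <= 12 / v ^+ 2.
  move=> /h1 vt; have t0 : 0 < t by exact: lt_le_trans vt.
  rewrite /h'' normrM mulrC; apply: ler_pM => //; first exact: norm_x3_phi_le.
  rewrite ger0_norm ?sqr_ge0// exprVn lef_pV2 ?posrE ?exprn_gt0//.
  by rewrite ler_pXn2r ?nnegrE ?(ltW v0) ?(ltW t0).
have := taylor2_bound dPhi dh' h''K.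
have := norm_x_phi_le (y / v).
have -> : h' v = - (y / v * phi (y / v)) / v by rewrite /h'; field.
set z := y / v * phi (y / v); set F := Phi (y / v') - _ => zK.
rewrite (ger0_norm D0); set D := v' - v in D0 *.
have sD : s ^+ 2 = D * (2 * v + D).
  by have -> : s ^+ 2 = v' ^+ 2 - v ^+ 2; [rewrite vs; ring|rewrite /D; ring].
move=> FK.
have -> : F - s ^+ 2 / (2 * v ^+ 2) * - z =
    (F - D * (- z / v)) + z * (D ^+ 2 / (2 * v ^+ 2)).
  by rewrite sD; field.
apply: le_trans (ler_normD _ _) _; move: FK; clearbody D z F.
have q0 : 0 <= D ^+ 2 / v ^+ 2 by rewrite divr_ge0 ?sqr_ge0.
(* [s ^+ 2 = D * (2 * v + D) >= 2 * v * D] *)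
have s4 : 4 * (D ^+ 2 / v ^+ 2) <= s ^+ 4 / v ^+ 4.
  have -> : 4 * (D ^+ 2 / v ^+ 2) = (D ^+ 2 * (2 * v) ^+ 2) / v ^+ 4 by field.
  rewrite ler_pM2r ?invr_gt0 ?exprn_gt0//.
  have -> : s ^+ 4 = D ^+ 2 * (2 * v + D) ^+ 2 by rewrite -exprMn -sD; ring.
  apply: ler_wpM2l; first exact: sqr_ge0.
  by have := mulr_ge0 (ltW v0) D0; have := sqr_ge0 D; lra.
have zq : `|z * (D ^+ 2 / (2 * v ^+ 2))| <= 3 / 4 * (D ^+ 2 / v ^+ 2).
  have -> : D ^+ 2 / (2 * v ^+ 2) = 2^-1 * (D ^+ 2 / v ^+ 2) by field.
  rewrite mulrA normrM [X in _ * X](ger0_norm q0); apply: ler_wpM2r => //.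
  by rewrite normrM [X in _ * X]ger0_norm//; lra.
rewrite (_ : 12 / v ^+ 2 * D ^+ 2 = 12 * (D ^+ 2 / v ^+ 2)); last by ring.
by move=> FK; lra.
Qed.

End normal.

(** * Moments of the standard normal distribution *)

Section normal_moments.
Context (R : realType).
Implicit Types (x y : R) (f F : R -> R).
Local Notation mu := (@lebesgue_measure R).
Local Notation phi := (@phi R).
Local Notation Phi := (@Phi R).

Lemma PhiE x : Phi x = fine (normal_prob (0 : R) 1 `]-oo, x]).
Proof. by []. Qed.

Let idTR : measurableTypeR R -> R := idfun.

#[local] HB.instance Definition _ :=
  @isMeasurableFun.Build _ _ _ _ idTR (@measurable_id _ _ setT).

Let idR : {RV (normal_prob (0 : R) 1) >-> R} := idTR.

Lemma PhiE_cdf x : (Phi x)%:E = cdf idR x.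
Proof. by rewrite PhiE fineK// fin_num_measure. Qed.

Lemma Phi_nondecreasing : {homo Phi : x y / x <= y}.
Proof. by move=> x y xy; rewrite -lee_fin !PhiE_cdf; exact: cdf_nondecreasing. Qed.

Lemma Phi_cvgy1 : Phi x @[x --> +oo] --> (1 : R).
Proof.
by have /fine_cvgP[] := cvg_cdfy1 idR. Qed.

Lemma Phi_cvgNy0 : Phi x @[x --> -oo] --> (0 : R).
Proof.
by have /fine_cvgP[] := cvg_cdfNy0 idR. Qed.

Lemma Phi_ge0 x : 0 <= Phi x.
Proof. by rewrite PhiE fine_ge0. Qed.

Lemma Phi_le1 x : Phi x <= 1.
Proof. by rewrite -lee_fin PhiE_cdf; exact: cdf_le1. Qed.

Lemma is_derive_continuous f (df : R -> R) :
  (forall x, is_derive x 1 f (df x)) -> continuous f.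
Proof.
move=> dfP x; apply: differentiable_continuous; apply/derivable1_diffP.
exact: (@ex_derive _ _ _ _ _ _ _ (dfP x)).
Qed.

Lemma continuous_Phi : continuous Phi.
Proof. by apply: (@is_derive_continuous _ phi) => x; exact: is_derive_Phi. Qed.

Lemma cvgy0_of_bound f (C : R) : (forall x, 1 <= x -> `|f x| <= C / x) ->
  f x @[x --> +oo] --> (0 : R).
Proof.
move=> fC; apply/cvgr0Pnorm_lt => eps eps0; near=> x.
have x1 : 1 <= x by near: x; apply: nbhs_pinfty_ge; exact: num_real.
have x0 : 0 < x by exact: lt_le_trans x1.
apply: le_lt_trans (fC x x1) _.
rewrite ltr_pdivrMr// -ltr_pdivrMl//.
by near: x; apply: nbhs_pinfty_gt; exact: num_real.
Unshelve. all: by end_near. Qed.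

(** The moments are computed on a half line, where the integrands have a sign
    and explicit primitives; parity gives the other half. *)
Lemma integral_half_line f F (df : R -> R) (l : R) :
  (forall x, is_derive x 1 F (f x)) -> (forall x, is_derive x 1 f (df x)) ->
  (forall x, 0 <= x -> 0 <= f x) -> F x @[x --> +oo] --> l ->
  (\int[mu]_(x in `[0%R, +oo[) (f x)%:E = (l - F 0)%:E)%E.
Proof.
move=> dF df_ f0 Fl.
have cF := is_derive_continuous dF; have cf := is_derive_continuous df_.
rewrite EFinB; apply: ge0_continuous_FTC2y => //.
- exact: continuous_subspaceT.
- by apply: cvg_at_right_filter; exact: cF.
- by move=> x _; rewrite derive1E; exact: (@derive_val _ _ _ _ _ _ _ (dF x)).
Qed.

Let phi_bounds x : 1 <= x -> [/\ x * phi x <= 2 / x, phi x <= 2 / x &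
  x ^+ 2 * phi x <= 16 / x].
Proof.
move=> x1; have x0 : 0 < x by lra.
have := sqr_phi_le x; have := pow4_phi_le x; have := phi_ge0 x.
set p := phi x => p0 p4 p2.
have p1 : p <= x * p by rewrite ler_peMl.
have xp : x * p <= 2 / x by rewrite ler_pdivlMr//; lra.
split => //; first exact: le_trans xp.
rewrite ler_pdivlMr//.
have := mulr_ge0 (sqr_ge0 x) p0.
have : x * (x ^+ 2 * p) <= x ^+ 2 * (x ^+ 2 * p).
  by apply: ler_wpM2r; [rewrite mulr_ge0 ?sqr_ge0|rewrite expr2 ler_peMl// ltW].
lra.
Qed.

Lemma half_moment0 : (\int[mu]_(x in `[0%R, +oo[) (phi x)%:E = (1 - Phi 0)%:E)%E.
Proof.
apply: (@integral_half_line phi Phi).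
- exact: is_derive_Phi.
- exact: is_derive_phi.
- by move=> x _; exact: phi_ge0.
- exact: Phi_cvgy1.
Qed.

Lemma half_moment1 :
  (\int[mu]_(x in `[0%R, +oo[) (x * phi x)%:E = (phi 0)%:E)%E.
Proof.
have d1 x : is_derive x 1 (fun t => -1 * phi t) (x * phi x).
  by apply: is_derive_eq (derive_scale _ (is_derive_phi x)) _; ring.
have := integral_half_line d1
  (fun x => derive_mul (derive_idr x) (is_derive_phi x)) _ _ (l := 0).
rewrite mulN1r opprK add0r; apply.
- by move=> x x0; rewrite mulr_ge0 ?phi_ge0.
- apply: (@cvgy0_of_bound _ 2) => x x1.
  rewrite mulN1r normrN ger0_norm ?phi_ge0//.
  by have [] := phi_bounds x1.
Qed.

Lemma half_moment2 :
  (\int[mu]_(x in `[0%R, +oo[) (x ^+ 2 * phi x)%:E = (1 - Phi 0)%:E)%E.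
Proof.
have d1 x : is_derive x 1 (fun t => Phi t - t * phi t) (x ^+ 2 * phi x).
  apply: is_derive_eq (derive_sub (is_derive_Phi x)
    (derive_mul (derive_idr x) (is_derive_phi x))) _.
  by ring.
have := integral_half_line d1
  (fun x => derive_mul (derive_sqr (derive_idr x)) (is_derive_phi x)) _ _ (l := 1).
rewrite mul0r subr0; apply.
- by move=> x x0; rewrite mulr_ge0 ?phi_ge0 ?sqr_ge0.
- rewrite -[X in _ --> X]subr0; apply: cvgB; first exact: Phi_cvgy1.
  apply: (@cvgy0_of_bound _ 2) => x x1.
  rewrite ger0_norm ?mulr_ge0 ?phi_ge0//; last by lra.
  by have [] := phi_bounds x1.
Qed.

Lemma half_moment3 :
  (\int[mu]_(x in `[0%R, +oo[) (x ^+ 3 * phi x)%:E = (2 * phi 0)%:E)%E.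
Proof.
have d1 x : is_derive x 1 (fun t => -1 * ((t ^+ 2 + 2) * phi t)) (x ^+ 2 * x * phi x).
  apply: is_derive_eq (derive_scale _ (derive_mul
    (derive_add (derive_sqr (derive_idr x)) (derive_cst 2 x)) (is_derive_phi x))) _.
  by ring.
have d2 x := derive_mul (derive_mul (derive_sqr (derive_idr x)) (derive_idr x))
  (is_derive_phi x).
under eq_integral do rewrite exprSr.
have -> : 2 * phi 0 = 0 - -1 * ((0 ^+ 2 + 2) * phi 0) by rewrite expr0n/= add0r mulN1r opprK add0r.
apply: (integral_half_line d1 d2).
- by move=> x x0; rewrite !mulr_ge0 ?phi_ge0 ?sqr_ge0.
- apply: (@cvgy0_of_bound _ 20) => x x1.
  rewrite mulN1r normrN ger0_norm ?mulr_ge0 ?phi_ge0 ?addr_ge0 ?sqr_ge0//.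
  have [_ h1 h2] := phi_bounds x1; rewrite mulrDl.
  have : 20 / x = 16 / x + 2 * (2 / x) by ring.
  lra.
Qed.

(** Integration against the standard normal law has density [phi]: [phi] is the
    Radon-Nikodym derivative of that law. *)
Lemma ge0_integral_normal (f : R -> \bar R) : measurable_fun setT f ->
  (forall x, 0 <= f x)%E ->
  (\int[normal_prob (0 : R) 1]_x f x = \int[mu]_x (f x * (phi x)%:E))%E.
Proof.
move=> mf f0; have dom := @normal_prob_dominates R 0 1.
rewrite -(Radon_Nikodym_SigmaFinite.change_of_variables dom f0 measurableT mf).
have iRN := Radon_Nikodym_SigmaFinite.f_integrable dom.
have mphi : measurable_fun setT (EFin \o phi).
  by apply/measurable_EFinP; exact: measurable_phi.
apply: ae_eq_integral => //.
- by apply: emeasurable_funM => //; exact: measurable_int iRN.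
- exact: emeasurable_funM.
- apply: ae_eqe_mul2l; apply: integral_ae_eq => //.
  by move=> E _ mE; rewrite -Radon_Nikodym_SigmaFinite.f_integral.
Qed.

Section standard_normal_variable.
Context d (T : measurableType d) (P : probability T R) (Z : T -> R).
Hypothesis mZ : measurable_fun setT Z.
Hypothesis lawZ : forall A : set R, measurable A ->
  P [set w | A (Z w)] = normal_prob 0 1 A.

Let Z' : {mfun T >-> R} := mfun_Sub (mem_set mZ).

Lemma ge0_integral_std_normal (g : R -> R) : measurable_fun setT g ->
  (forall x, 0 <= g x) ->
  (\int[P]_w (g (Z w))%:E = \int[mu]_x (g x * phi x)%:E)%E.
Proof.
move=> mg g0.
have mg' : measurable_fun setT (fun x : R => (g x)%:E) by exact/measurable_EFinP.
rewrite -(@ge0_integral_distribution _ _ _ _ _ P Z' (fun x => (g x)%:E))//.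
rewrite (eq_measure_integral (distribution (normal_prob (0 : R) 1) idR)); last first.
  by move=> A mA _; exact: lawZ.
rewrite ge0_integral_distribution//.
by rewrite ge0_integral_normal.
Qed.

Let even_integral (g : R -> R) : continuous g -> (forall x, 0 <= g x) ->
  (forall x, g (- x) = g x) ->
  (\int[P]_w (g (Z w))%:E = 2%:E * \int[mu]_(x in `[0%R, +oo[) (g x * phi x)%:E)%E.
Proof.
move=> cg g0 gN; rewrite ge0_integral_std_normal//; last first.
  exact: continuous_measurable_fun.
rewrite (@ge0_symfun_integralT R (fun x => g x * phi x)).
- by rewrite -set_itvcy.
- by move=> x; rewrite mulr_ge0 ?phi_ge0.
- by move=> x; apply: cvgM; [exact: cg|exact: continuous_phi].
- by move=> x /=; rewrite gN phiN.
Qed.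

Let half : Phi 0 = 2^-1.
Proof.
have c1 : continuous (fun _ : R => 1 : R) by move=> x; exact: cvg_cst.
have := even_integral c1 (fun _ => ler01) (fun _ => erefl).
rewrite integral_cst//= (_ : P setT = 1%E); last exact: probability_setT.
under eq_integral do rewrite mul1r.
by rewrite half_moment0 mule1 -EFinM => /(congr1 fine)/=; lra.
Qed.

Lemma std_normal_integ_sqr : integ P (fun w => Z w ^+ 2).
Proof.
apply: integP; first exact: measurable_funX.
under eq_integral do rewrite ger0_norm ?sqr_ge0//.
rewrite (@even_integral (fun x => x ^+ 2)).
- by rewrite half_moment2 -EFinM ltry.
- exact: sqr_continuous.
- by move=> x; exact: sqr_ge0.
- by move=> x; rewrite sqrrN.
Qed.

Lemma std_normal_second_moment : \int[P]_w (Z w ^+ 2) = 1.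
Proof.
rewrite /Rintegral (@even_integral (fun x => x ^+ 2)).
- by rewrite half_moment2 -EFinM half/=; lra.
- exact: sqr_continuous.
- by move=> x; exact: sqr_ge0.
- by move=> x; rewrite sqrrN.
Qed.

Let third_moment : (\int[P]_w (`|Z w| ^+ 3)%:E = (4 * phi 0)%:E)%E.
Proof.
rewrite (@even_integral (fun x => `|x| ^+ 3)).
- rewrite (_ : 4 * phi 0 = 2 * (2 * phi 0)); last by ring.
  rewrite EFinM -half_moment3; congr (_ * _)%E; apply: eq_integral => x.
  by rewrite inE/= in_itv/= andbT => x0; rewrite ger0_norm.
- move=> x.
  apply: (@continuous_comp _ _ _ (fun y : R => `|y|) (fun y : R => y ^+ 3)).
    exact: (@norm_continuous _ R^o).
  exact: exprn_continuous.
- by move=> x; rewrite exprn_ge0.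
- by move=> x; rewrite normrN.
Qed.

Lemma std_normal_integ_norm3 : integ P (fun w => `|Z w| ^+ 3).
Proof.
apply: integP; first by apply: measurable_funX; exact: measurable_fun_norm.
under eq_integral do rewrite ger0_norm ?exprn_ge0//.
by rewrite third_moment ltry.
Qed.

Lemma std_normal_third_moment : \int[P]_w (`|Z w| ^+ 3) <= 4.
Proof.
by rewrite /Rintegral third_moment/=; have := @phi_le1 R 0; lra.
Qed.

Lemma std_normal_mean : \int[P]_w Z w = 0.
Proof.
have iZ : integ P Z by apply: integ_of_sqr => //; exact: std_normal_integ_sqr.
(* reduces the signed integral to integrals of nonnegative functions *)
have ZE w : Z w = 2 * Num.max (Z w) 0 - `|Z w|.
  case: (lerP 0 (Z w)) => Z0; first by rewrite ger0_norm//; ring.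
  by rewrite ltr0_norm//; ring.
have mmax : measurable_fun setT (fun x : R => Num.max x 0).
  exact: measurable_maxr.
have iabs : integ P (fun w => `|Z w|).
  apply: (integ_le (measurable_fun_norm mZ) iZ) => w; by rewrite normr_id.
have imax : integ P (fun w => Num.max (Z w) 0).
  apply: (integ_le _ iZ) => [|w]; first exact: (measurableT_comp mmax).
  by case: (lerP 0 (Z w)) => // _; rewrite normr0.
have Eabs : \int[P]_w `|Z w| = 2 * phi 0.
  rewrite /Rintegral (@even_integral (fun x => `|x|)).
  - rewrite -[RHS]/(fine (2 * phi 0)%:E) EFinM -half_moment1; congr (fine (_ * _)).
    apply: eq_integral => x.
    by rewrite inE/= in_itv/= andbT => x0; rewrite ger0_norm.
  - exact: (@norm_continuous _ R^o).
  - by [].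
  - by move=> x; rewrite normrN.
have Emax : \int[P]_w (Num.max (Z w) 0) = phi 0.
  rewrite /Rintegral (@ge0_integral_std_normal (fun x => Num.max x 0))//; last first.
    by move=> x; rewrite le_max lexx orbT.
  rewrite -[RHS]/(fine (phi 0)%:E) -half_moment1 [in RHS]integral_mkcond.
  congr fine; apply: eq_integral => x _; rewrite patchE mem_setE in_itv/= andbT.
  by case: (lerP 0 x) => // _; rewrite mul0r.
under eq_Rintegral do rewrite ZE.
by rewrite RintegralB// ?RintegralZl// ?Eabs ?Emax ?subrr//; exact: integZ.
Qed.

End standard_normal_variable.
End normal_moments.

(** * The Lindeberg central limit theorem *)

Section lindeberg.
Context d (T : measurableType d) (R : realType) (P : probability T R).
Variables (X : nat -> T -> R) (n : nat) (a : nat -> R) (M : R).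
Hypothesis mX : forall i, measurable_fun setT (X i).
Hypothesis indX : mutually_independent P (fun i : 'I_n => X i).
Hypothesis EX0 : forall i, (i < n)%N -> \int[P]_w X i w = 0.
Hypothesis iX2 : forall i, (i < n)%N -> integ P (fun w => X i w ^+ 2).
Hypothesis EX2 : forall i, (i < n)%N -> \int[P]_w (X i w ^+ 2) = 1.
Hypothesis iX3 : forall i, (i < n)%N -> integ P (fun w => `|X i w| ^+ 3).
Hypothesis EX3 : forall i, (i < n)%N -> \int[P]_w (`|X i w| ^+ 3) <= M.

Local Notation W := (wsum X a).
Local Notation phi := (@phi R).
Local Notation Phi := (@Phi R).

Lemma measurable_Phi : measurable_fun setT Phi.
Proof. apply: continuous_measurable_fun; exact: continuous_Phi. Qed.

Let measurable_arg (x v : R) k : measurable_fun setT (fun w => (x - W k w) / v).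
Proof.
apply: measurable_funM => //; apply: measurable_funB => //.
exact: measurable_wsum.
Qed.

Lemma integ_Phi (f : T -> R) : measurable_fun setT f -> integ P (fun w => Phi (f w)).
Proof.
move=> mf; apply: (@integ_bounded _ _ _ _ _ 1).
  by apply: (measurableT_comp measurable_Phi).
by move=> w; rewrite ger0_norm ?Phi_ge0 ?Phi_le1.
Qed.

(** The expansions of [Phi] in space (adding the summand [s * xi]) and in scale
    (adding the variance [s ^+ 2]) are subtracted. What remains besides the
    error terms is a combination of [xi] and [xi ^+ 2 - 1]. *)
Let lindeberg_pointwise (x v v' s W0 xi z : R) : 0 < v -> v <= v' ->
  v' ^+ 2 = v ^+ 2 + s ^+ 2 -> z = (x - W0) / v ->
  `|(Phi ((x - (W0 + s * xi)) / v) - Phi ((x - W0) / v'))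
    - ((- (s / v)) * (phi z * xi) + (- (s ^+ 2 / (2 * v ^+ 2))) * (z * phi z * (xi ^+ 2 - 1)))|
  <= (3 * (`|s| / v) ^+ 3) * `|xi| ^+ 3 + 4 * (s ^+ 4 / v ^+ 4).
Proof.
move=> v0 vv' vs zE.
have vn0 : v != 0 by rewrite gt_eqF.
have h1 := Phi_scale_taylor (x - W0) v0 vv' vs.
have h2 := Phi_taylor3 z ((x - (W0 + s * xi)) / v).
have e1 : (x - (W0 + s * xi)) / v - z = - (s * xi / v).
  by rewrite zE; field.
rewrite e1 in h2.
have e2 : `|- (s * xi / v)| ^+ 3 = (`|s| / v) ^+ 3 * `|xi| ^+ 3.
  by rewrite normrN !normrM normfV (gtr0_norm v0); ring.
rewrite e2 in h2; rewrite -zE in h1.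
rewrite -[3 * _ * _]mulrA.
apply: le_trans (lerD h2 h1).
apply: le_trans (ler_normB _ _).
rewrite le_eqVlt; apply/orP; left; apply/eqP; congr (`| _ |).
by field.
Qed.

(** Replacing one more summand by an increment of the heat flow: the terms of
    order one and two of both expansions agree in expectation, because the
    summand is centred, has variance one and is independent of the past. *)
Lemma lindeberg_step k (x v v' : R) : (k < n)%N -> 0 < v -> v <= v' ->
  v' ^+ 2 = v ^+ 2 + a k ^+ 2 ->
  `|\int[P]_w Phi ((x - W k.+1 w) / v) - \int[P]_w Phi ((x - W k w) / v')|
  <= (3 * (`|a k| / v) ^+ 3) * M + 4 * (a k ^+ 4 / v ^+ 4).
Proof.
move=> kn v0 vv' vs; have vn0 : v != 0 by rewrite gt_eqF.
pose z w := (x - W k w) / v.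
pose A w := phi (z w) * X k w.
pose B w := z w * phi (z w) * (X k w ^+ 2 - 1).
have iXk := integ_of_sqr (mX k) (iX2 kn).
have iX2k : integ P (fun w => X k w ^+ 2 - 1) by apply: integB;
  [exact: iX2|exact: integ_cst].
have mphi := @measurable_phi R.
have mz := measurable_arg x v k.
have mpz : measurable_fun setT (fun w => phi (z w)) by apply: (measurableT_comp mphi).
have ipz : integ P (fun w => phi (z w)).
  by apply: (@integ_bounded _ _ _ P _ 1) => // w; rewrite ger0_norm ?phi_ge0 ?phi_le1.
have izpz : integ P (fun w => z w * phi (z w)).
  apply: (@integ_bounded _ _ _ P _ (3 / 2)) => [|w]; first exact: measurable_funM.
  exact: norm_x_phi_le.
have mzR : measurable_fun setT (fun t : R => (x - t) / v).
  by apply: measurable_funM => //; exact: measurable_funB.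
have mphiR : measurable_fun setT (fun t : R => phi ((x - t) / v)).
  exact: (measurableT_comp mphi).
have mzphiR : measurable_fun setT (fun t : R => (x - t) / v * phi ((x - t) / v)).
  exact: measurable_funM.
have msqr1 : measurable_fun setT (fun t : R => t ^+ 2 - 1).
  by apply: measurable_funB => //; exact: measurable_funX.
have indWX := indep2_wsum mX indX a kn.
have indA : indep2 P (fun w => phi (z w)) (X k).
  exact: (indep2_comp mphiR (@measurable_id _ _ setT) indWX).
have indB : indep2 P (fun w => z w * phi (z w)) (fun w => X k w ^+ 2 - 1).
  exact: (indep2_comp mzphiR msqr1 indWX).
have iA : integ P A := indep2_integM ipz iXk indA.
have iB : integ P B := indep2_integM izpz iX2k indB.
have EA : \int[P]_w A w = 0 by rewrite indep2_RintegralM// EX0// mulr0.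
have EB : \int[P]_w B w = 0.
  rewrite indep2_RintegralM// RintegralB//; last 2 first.
  - exact: iX2.
  - exact: integ_cst.
  by rewrite EX2// Rintegral_cst_prob subrr mulr0.
pose C w := (- (a k / v)) * A w + (- (a k ^+ 2 / (2 * v ^+ 2))) * B w.
have iC : integ P C by apply: integD; exact: integZ.
have EC : \int[P]_w C w = 0.
  by rewrite RintegralD ?RintegralZl ?EA ?EB ?mulr0 ?addr0//; exact: integZ.
have i1 : integ P (fun w => Phi ((x - W k.+1 w) / v)) by exact: integ_Phi.
have i2 : integ P (fun w => Phi ((x - W k w) / v')) by exact: integ_Phi.
rewrite -RintegralB// -[X in `|X|]subr0 -EC -RintegralB//; last exact: integB.
apply: le_trans (norm_Rintegral_le (Y := fun w =>
  (3 * (`|a k| / v) ^+ 3) * `|X k w| ^+ 3 + 4 * (a k ^+ 4 / v ^+ 4)) _ _ _) _.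
- by apply: integB => //; exact: integB.
- by apply: integD; [apply: integZ; exact: iX3|exact: integ_cst].
- move=> w; rewrite /wsum big_ord_recr/=.
  exact: lindeberg_pointwise.
- rewrite RintegralD//; [|by apply: integZ; exact: iX3|exact: integ_cst].
  rewrite Rintegral_cst_prob lerD2r RintegralZl// ?iX3//; apply: ler_wpM2l;
    last exact: EX3.
  by rewrite mulr_ge0// exprn_ge0// divr_ge0// ltW.
Qed.

(** Lindeberg's telescoping sum. The mean of [Phi ((x - W k) / t k)] is the
    probability that the first [k] summands, plus a normal variable with the
    variance of the other ones and of a smoothing of size [delta], lie below [x];
    passing from [k] to [k.+1] replaces one normal summand by the true one. *)
Lemma lindeberg_smooth (x delta : R) : 0 < delta -> 0 <= M ->
  `|\int[P]_w Phi ((x - W n w) / delta)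
     - Phi (x / Num.sqrt (delta ^+ 2 + \sum_(i < n) a i ^+ 2))|
  <= \sum_(i < n) (3 * (`|a i| / delta) ^+ 3 * M + 4 * (a i ^+ 4 / delta ^+ 4)).
Proof.
move=> d0 M0.
pose t k := Num.sqrt (delta ^+ 2 + \sum_(k <= i < n) a i ^+ 2).
have sum0 k : 0 <= \sum_(k <= i < n) a i ^+ 2.
  by apply: sumr_ge0 => i _; exact: sqr_ge0.
have tdelta k : delta <= t k.
  rewrite -[leLHS](gtr0_norm d0) -sqrtr_sqr /t ler_wsqrtr//.
  by rewrite lerDl.
have t0 k : 0 < t k by exact: lt_le_trans (tdelta k).
have tS k : (k < n)%N -> t k ^+ 2 = t k.+1 ^+ 2 + a k ^+ 2.
  move=> kn; rewrite /t !sqr_sqrtr ?addr_ge0 ?sqr_ge0//.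
  by rewrite [in LHS]big_ltn//; ring.
suff H k : (k <= n)%N -> `|\int[P]_w Phi ((x - W k w) / t k) - Phi (x / t 0%N)|
    <= \sum_(i < k) (3 * (`|a i| / delta) ^+ 3 * M + 4 * (a i ^+ 4 / delta ^+ 4)).
  have tn : t n = delta by rewrite /t big_geq// addr0 sqrtr_sqr gtr0_norm.
  have t00 : t 0%N = Num.sqrt (delta ^+ 2 + \sum_(i < n) a i ^+ 2).
    by rewrite /t big_mkord.
  by have := H n (leqnn n); rewrite tn t00.
elim: k => [_|k IH kn].
  under eq_Rintegral do rewrite /wsum big_ord0 subr0.
  by rewrite Rintegral_cst_prob subrr normr0 big_ord0.
rewrite big_ord_recr/=.
apply: le_trans (ler_distD (\int[P]_w Phi ((x - W k w) / t k)) _ _) _.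
rewrite [leLHS]addrC; apply: lerD; first exact: IH (ltnW kn).
apply: le_trans (lindeberg_step x kn (t0 k.+1) _ (tS k kn)) _.
  by rewrite /t ler_wsqrtr// lerD2l [leRHS]big_ltn// lerDr sqr_ge0.
have dt m : delta ^+ m <= t k.+1 ^+ m by rewrite lerXn2r ?nnegrE ?(ltW d0) ?(ltW (t0 _)).
apply: lerD.
  apply: ler_wpM2r => //; apply: ler_wpM2l => //.
  rewrite lerXn2r ?nnegrE ?divr_ge0 ?(ltW d0) ?(ltW (t0 _))//.
  by apply: ler_wpM2l => //; rewrite lef_pV2 ?posrE.
apply: ler_wpM2l => //; apply: ler_wpM2l; first by rewrite exprn_even_ge0.
by rewrite lef_pV2 ?posrE ?exprn_gt0.
Qed.

End lindeberg.

Section clt.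
Context (R : realType).
Local Notation Phi := (@Phi R).

Lemma Phi_continuity_modulus (x eps : R) : 0 < eps ->
  exists2 rho, 0 < rho & forall y, `|y - x| <= rho -> `|Phi y - Phi x| <= eps.
Proof.
move=> e0.
have /cvgrPdist_le/(_ _ e0)/nbhs_ballP[r /= r0 rP] := @continuous_Phi R x.
exists (r / 2) => [|y yr]; first by rewrite divr_gt0.
rewrite distrC; apply: rP; rewrite /ball/= distrC; apply: le_lt_trans yr _.
by rewrite ltr_pdivrMr// ltr_pMr// ltr1n.
Qed.

Lemma Phi_tails (eps : R) : 0 < eps ->
  exists2 A, 0 < A & 1 - eps <= Phi A /\ Phi (- A) <= eps.
Proof.
move=> e0.
have h1 : \forall A \near +oo, `|1 - Phi A| <= eps.
  by have /cvgrPdist_le/(_ _ e0) := @Phi_cvgy1 R.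
have h2 : \forall A \near +oo, `|0 - Phi (- A)| <= eps.
  have := @Phi_cvgNy0 R; rewrite cvgNy_compNP => /cvgrPdist_le/(_ _ e0); exact.
have h3 : \forall A \near +oo%R, (0 : R) < A by exact: nbhs_pinfty_gt.
have [A [A0 [a1 a2]]] : exists A : R, 0 < A /\ (`|1 - Phi A| <= eps /\ `|0 - Phi (- A)| <= eps).
  have /filter_ex[A AP] : \forall A \near +oo%R, (0 : R) < A /\ (`|1 - Phi A| <= eps /\ `|0 - Phi (- A)| <= eps).
    by near=> A; split; [|split]; near: A.
  by exists A.
exists A => //; split.
- by move: a1; rewrite ler_norml => /andP[_]; lra.
- by move: a2; rewrite ler_norml => /andP[]; lra.
Unshelve. all: by end_near. Qed.

(** [eta] is chosen first, by continuity of [Phi] at [x]; then [delta] is taken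
    so small that [eta / delta] is far in the tails of [Phi] and that smoothing
    at scale [delta] barely changes the unit variance. *)
Lemma smoothing_scales (x eps : R) : 0 < eps -> exists eta delta : R,
  [/\ 0 < delta, 1 - eps <= Phi (eta / delta), Phi (- (eta / delta)) <= eps,
      `|Phi ((x + eta) / Num.sqrt (delta ^+ 2 + 1)) - Phi x| <= eps &
      `|Phi ((x - eta) / Num.sqrt (delta ^+ 2 + 1)) - Phi x| <= eps].
Proof.
move=> e0.
have [rho rho0 rhoP] := @Phi_continuity_modulus x _ e0.
have [A A0 [A1 A2]] := Phi_tails e0.
pose eta := rho / 2; have eta0 : 0 < eta by rewrite divr_gt0.
pose K := `|x| + eta + 1.
have K0 : 0 < K by rewrite /K ltr_wpDl// addr_ge0// ltW.
pose delta := Num.min 1 (Num.min (eta / A) (eta / K)).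
have d0 : 0 < delta by rewrite !lt_min ltr01 !divr_gt0.
have d1 : delta <= 1 by rewrite ge_min lexx.
have dA : delta <= eta / A by rewrite !ge_min lexx orbT.
have dK : delta <= eta / K by rewrite !ge_min lexx !orbT.
have Aed : A <= eta / delta by rewrite ler_pdivlMr// mulrC -ler_pdivlMr.
pose s := Num.sqrt (delta ^+ 2 + 1).
have s1 : 1 <= s by rewrite -[leLHS]sqrtr1 ler_wsqrtr// lerDr sqr_ge0.
have s0 : 0 < s by exact: lt_le_trans s1.
have sd : s - 1 <= delta.
  have : s ^+ 2 = delta ^+ 2 + 1 by rewrite sqr_sqrtr// addr_ge0 ?sqr_ge0.
  have := ltW d0; nra.
have near_x y : `|y - x| <= eta -> `|y / s - x| <= rho.
  move=> yx; rewrite (_ : rho = eta + eta); last by rewrite /eta; field.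
  apply: le_trans (ler_distD y _ _) _; apply: lerD => //.
  rewrite (_ : y / s - y = - (y * ((s - 1) / s))); last by field; rewrite gt_eqF.
  rewrite normrN normrM.
  have yK : `|y| <= K.
    rewrite /K -[y](subrK x); apply: le_trans (ler_normD _ _) _.
    by rewrite [leRHS]addrAC addrC; apply: lerD => //; lra.
  apply: le_trans (_ : K * delta <= _); last by rewrite mulrC -ler_pdivlMr.
  apply: ler_pM => //.
  rewrite ger0_norm ?divr_ge0 ?subr_ge0 ?(ltW s0)// ler_pdivrMr//.
  by apply: le_trans sd _; rewrite ler_peMr// ltW.
exists eta, delta; split => //.
- by apply: le_trans A1 _; exact: Phi_nondecreasing.
- by apply: le_trans A2; apply: Phi_nondecreasing; rewrite lerN2.
- by apply: rhoP; apply: near_x; rewrite addrC addKr ger0_norm// ltW.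
- by apply: rhoP; apply: near_x; rewrite addrC addKr normrN ger0_norm// ltW.
Qed.

(** The variables need not be identically distributed; [M] only enters through
    the error bounds, which makes the limit theorems uniform over all noises
    with the same [M]. *)
Definition standardized_noise d (T : measurableType d) (P : probability T R)
    (X : nat -> T -> R) (n : nat) (M : R) :=
  [/\ forall i, measurable_fun setT (X i),
      mutually_independent P (fun i : 'I_n => X i)
    & forall i, (i < n)%N ->
      [/\ \int[P]_w X i w = 0, integ P (fun w => X i w ^+ 2),
          \int[P]_w (X i w ^+ 2) = 1, integ P (fun w => `|X i w| ^+ 3)
        & \int[P]_w (`|X i w| ^+ 3) <= M]].

Lemma sandwich (p I1 I2 F1 F2 F e : R) : p <= I1 + e / 3 -> I2 - e / 3 <= p ->
  `|I1 - F1| <= e / 3 -> `|I2 - F2| <= e / 3 -> `|F1 - F| <= e / 3 ->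
  `|F2 - F| <= e / 3 -> `|p - F| <= e.
Proof.
rewrite !ler_norml => ? ? /andP[? ?] /andP[? ?] /andP[? ?] /andP[? ?].
by apply/andP; split; lra.
Qed.

(** Lyapunov's theorem, uniformly in the probability space, the number of terms
    and the weights. The indicator of [W <= x] lies between two functions
    [Phi ((x -+ eta - W) / delta)] up to a small error, and these are the test
    functions that the heat flow turns into values of [Phi] near [x]. *)
Lemma lyapunov_clt (x eps M : R) : 0 < eps -> 0 <= M ->
  exists2 kappa, 0 < kappa &
  forall d (T : measurableType d) (P : probability T R) (X : nat -> T -> R)
    (n : nat) (a : nat -> R),
  standardized_noise P X n M -> \sum_(i < n) a i ^+ 2 = 1 ->
  \sum_(i < n) `|a i| ^+ 3 <= kappa ->
  `|pr P [set w | wsum X a n w <= x] - Phi x| <= eps.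
Proof.
move=> e0 M0; have e3 : 0 < eps / 3 by rewrite divr_gt0.
have [eta [delta [d0 hp hm h1 h2]]] := smoothing_scales x e3.
pose C := 3 / delta ^+ 3 * M + 4 / delta ^+ 4.
have C0 : 0 < C by rewrite ltr_wpDl ?divr_gt0 ?exprn_gt0// mulr_ge0// divr_ge0// exprn_ge0// ltW.
(* [C] bounds each error term of [lindeberg_smooth], as [|a i| <= 1]. *)
exists (eps / 3 / C); first by rewrite divr_gt0.
move=> d T P X n a [mX indX HX] a2 a3.
have smooth y : `|\int[P]_w Phi ((y - wsum X a n w) / delta)
     - Phi (y / Num.sqrt (delta ^+ 2 + 1))| <= eps / 3.
  rewrite -[in Phi _]a2.
  apply: le_trans (@lindeberg_smooth _ _ _ P X n a M mX indX _ _ _ _ _ y delta d0 M0) _;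
    try by move=> i /HX[].
  apply: le_trans (_ : \sum_(i < n) C * `|a i| ^+ 3 <= _); last first.
    by rewrite -mulr_sumr mulrC -ler_pdivlMr.
  apply: ler_sum => i _.
  have a1 : `|a i| <= 1.
    rewrite -(@ler_pXn2r _ 2) ?nnegrE// expr1n (real_normK (num_real _)) -a2.
    by rewrite (bigD1 i)//= lerDl sumr_ge0// => j _; exact: sqr_ge0.
  have a4 : a i ^+ 4 <= `|a i| ^+ 3.
    rewrite (_ : a i ^+ 4 = `|a i| ^+ 4);
      last by rewrite -normrX ger0_norm// exprn_even_ge0.
    by rewrite [leLHS]exprS ler_piMl// exprn_ge0.
  rewrite (_ : C * `|a i| ^+ 3 = 3 / delta ^+ 3 * M * `|a i| ^+ 3
    + 4 / delta ^+ 4 * `|a i| ^+ 3); last by rewrite /C; ring.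
  apply: lerD.
    rewrite le_eqVlt; apply/orP; left; apply/eqP; field; by rewrite gt_eqF.
  rewrite -mulrA; apply: ler_wpM2l => //; rewrite mulrC; apply: ler_wpM2l => //.
  by rewrite invr_ge0 exprn_ge0// ltW.
have mW := measurable_wsum mX a n.
have mA : measurable [set w | wsum X a n w <= x] by exact: measurable_le_set.
have marg y : measurable_fun setT (fun w => (y - wsum X a n w) / delta).
  by apply: measurable_funM => //; exact: measurable_funB.
have iPhi y : integ P (fun w => Phi ((y - wsum X a n w) / delta)) by exact: integ_Phi.
rewrite -Rintegral_indic//.
have up : \int[P]_w (\1_[set w | wsum X a n w <= x] w)
    <= \int[P]_w Phi ((x + eta - wsum X a n w) / delta) + eps / 3.
  rewrite -[X in _ <= _ + X](Rintegral_cst_prob P) -RintegralD//;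
    last exact: integ_cst.
  apply: Rintegral_le => [||w]; first exact: integ_indic.
    by apply: integD => //; exact: integ_cst.
  rewrite indicE; case: (boolP (w \in _)) => [|_];
    last by rewrite addr_ge0 ?Phi_ge0 ?ltW.
  rewrite inE/= => Wx; rewrite -lerBlDr; apply: le_trans hp _.
  by apply: Phi_nondecreasing; rewrite ler_pM2r ?invr_gt0//; lra.
have lo : \int[P]_w Phi ((x - eta - wsum X a n w) / delta) - eps / 3
    <= \int[P]_w (\1_[set w | wsum X a n w <= x] w).
  rewrite lerBlDr -[X in _ <= _ + X](Rintegral_cst_prob P) -RintegralD//;
    last 2 first.
  - exact: integ_indic.
  - exact: integ_cst.
  apply: Rintegral_le => [//||w].
    by apply: integD; [exact: integ_indic|exact: integ_cst].
  rewrite indicE; case: (boolP (w \in _)) => [_|].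
    by apply: le_trans (Phi_le1 _) _; rewrite lerDl ltW.
  rewrite notin_setE/= => /negP; rewrite -ltNge => xW; rewrite add0r.
  apply: le_trans hm; apply: Phi_nondecreasing.
  by rewrite -mulNr ler_pM2r ?invr_gt0//; lra.
exact: sandwich up lo (smooth _) (smooth _) h1 h2.
Qed.

End clt.

(** * Convergence in law and in probability *)

Section slutsky.
Context (R : realType).
Local Notation Phi := (@Phi R).

(** On the event that [Q] is close to one and [E] is close to zero, the event
    [Y <= x] for [Y = (Z + E) / Q] lies between two events [Z <= y] with [y]
    close to [x]. *)
Lemma slutsky (x eps : R) : 0 < eps -> exists eta y1 y2 : R, 0 < eta /\
  forall d (T : measurableType d) (P : probability T R) (Z Q E Y : T -> R),
  measurable_fun setT Z -> measurable_fun setT Q -> measurable_fun setT E ->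
  measurable_fun setT Y ->
  (forall w, 0 < Q w -> Y w * Q w = Z w + E w) ->
  `|pr P [set w | Z w <= y1] - Phi y1| <= eta ->
  `|pr P [set w | Z w <= y2] - Phi y2| <= eta ->
  pr P [set w | eta < `|Q w - 1|] <= eta ->
  pr P [set w | eta < `|E w|] <= eta ->
  `|pr P [set w | Y w <= x] - Phi x| <= eps.
Proof.
move=> e0; have e2 : 0 < eps / 2 by rewrite divr_gt0.
have [rho rho0 rhoP] := @Phi_continuity_modulus R x _ e2.
(* If [|Q - 1| <= eta] and [|E| <= eta], then [Y <= x] gives
   [Z = Y * Q - E <= x + K * eta]. *)
pose K := `|x| + 1; have K0 : 0 < K by rewrite ltr_wpDl.
pose eta := Num.min 2^-1 (Num.min (eps / 6) (rho / K)).
have eta0 : 0 < eta by rewrite !lt_min invr_gt0 ltr0n /= !divr_gt0.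
have eta1 : eta <= 2^-1 by rewrite ge_min lexx.
have eta6 : eta <= eps / 6 by rewrite !ge_min lexx orbT.
have etaK : K * eta <= rho by rewrite mulrC -ler_pdivlMr// !ge_min lexx !orbT.
exists eta, (x - K * eta), (x + K * eta); split => //.
move=> d T P Z Q E Y mZ mQ mE mY YQ h1 h2 hQ hE.
have Keta0 : 0 <= K * eta by rewrite mulr_ge0 ?ltW.
have r1 : `|Phi (x - K * eta) - Phi x| <= eps / 2.
  by apply: rhoP; rewrite addrC addKr normrN ger0_norm.
have r2 : `|Phi (x + K * eta) - Phi x| <= eps / 2.
  by apply: rhoP; rewrite addrC addKr ger0_norm.
have mle (f : T -> R) c : measurable_fun setT f -> measurable [set w | f w <= c].
  by move=> mf; exact: measurable_le_set.
have mlt (f : T -> R) c : measurable_fun setT f -> measurable [set w | c < `|f w|].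
  by move=> mf; apply: measurable_lt_set => //; exact: measurable_fun_norm.
have mQ1 : measurable_fun setT (fun w => Q w - 1) by exact: measurable_funB.
have key w : `|Q w - 1| <= eta -> `|E w| <= eta ->
    (Y w <= x -> Z w <= x + K * eta) /\ (Z w <= x - K * eta -> Y w <= x).
  rewrite !ler_norml => /andP[q1 q2] /andP[E1 E2].
  have Q0 : 0 < Q w by lra.
  have xQ : `|x * (Q w - 1)| <= `|x| * eta.
    by rewrite normrM ler_wpM2l// ler_norml q1.
  move: xQ; rewrite ler_norml => /andP[x1 x2].
  rewrite -(ler_pM2r Q0) YQ// /K; split => h; lra.
have bad : measurable ([set w | eta < `|Q w - 1|] `|` [set w | eta < `|E w|]).
  by apply: measurableU; exact: mlt.
have prbad : pr P ([set w | eta < `|Q w - 1|] `|` [set w | eta < `|E w|]) <= eta + eta.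
  apply: le_trans (pr_leU P bad (mlt _ _ mQ1) (mlt _ _ mE) (@subset_refl _ _)) _.
  exact: lerD.
have good w : ~ ([set w | eta < `|Q w - 1|] `|` [set w | eta < `|E w|]) w ->
    `|Q w - 1| <= eta /\ `|E w| <= eta.
  by move=> /not_orP[/= /negP + /negP]; rewrite -!leNgt.
have up : pr P [set w | Y w <= x] <= pr P [set w | Z w <= x + K * eta] + (eta + eta).
  apply: le_trans (_ : _ <= pr P [set w | Z w <= x + K * eta] + pr P _) _;
    last by rewrite lerD2l; exact: prbad.
  apply: pr_leU => //; [exact: mle|exact: mle|] => w /= Yx.
  have [|/good[q E']] := pselect (([set w | eta < `|Q w - 1|] `|` [set w | eta < `|E w|]) w).
    by right.
  by left; exact: (key w q E').1 Yx.
have lo : pr P [set w | Z w <= x - K * eta] <= pr P [set w | Y w <= x] + (eta + eta).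
  apply: le_trans (_ : _ <= pr P [set w | Y w <= x] + pr P _) _;
    last by rewrite lerD2l; exact: prbad.
  apply: pr_leU => //; [exact: mle|exact: mle|] => w /= Yx.
  have [|/good[q E']] := pselect (([set w | eta < `|Q w - 1|] `|` [set w | eta < `|E w|]) w).
    by right.
  by left; exact: (key w q E').2 Yx.
move: h1 h2 r1 r2 up lo; clear - eta6.
set p := pr P _; set p1 := pr P _; set p2 := pr P _.
set F := Phi x; set F1 := Phi _; set F2 := Phi _.
clearbody p p1 p2 F F1 F2 eta.
rewrite !ler_norml => /andP[? ?] /andP[? ?] /andP[? ?] /andP[? ?] ? ?.
by apply/andP; split; lra.
Qed.

End slutsky.

Section ae_to_probability.
Context d (T : measurableType d) (R : realType) (P : probability T R).

(** Almost sure convergence makes the limit superior of the events negligible,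
    and the unions of their tails decrease to it. *)
Lemma ae_cvg0_pr (f : nat -> T -> R) (eta : R) :
  (forall n, measurable_fun setT (f n)) ->
  {ae P, forall w, f n w @[n --> \oo] --> (0 : R)} -> 0 < eta ->
  pr P [set w | eta < `|f n w|] @[n --> \oo] --> (0 : R).
Proof.
move=> mf fae eta0.
pose F n := [set w | eta < `|f n w|].
have mF n : measurable (F n).
  by apply: measurable_lt_set => //; exact: measurable_fun_norm.
have PF : P (\bigcup_(k >= n) F k) @[n --> \oo] --> P (lim_sup_set F).
  apply: lim_sup_set_cvg => //.
  by rewrite ltey_eq fin_num_measure//; exact: bigcup_measurable.
have PF0 : P (lim_sup_set F) = 0%E.
  have mL : measurable (lim_sup_set F).
    by apply: bigcap_measurable => // n _; exact: bigcup_measurable.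
  case: fae => N [mN PN fN].
  apply/eqP; rewrite eq_le measure_ge0 andbT -PN le_measure ?inE//.
  move=> w Lw; apply: fN => /= fw.
  have /cvgr0Pnorm_lt/(_ _ eta0)[n _ nP] := fw.
  have [k /= nk] := Lw n I.
  by rewrite /F/= => /lt_trans/(_ (nP k nk)); rewrite ltxx.
rewrite PF0 in PF.
have PF' : pr P (\bigcup_(k >= n) F k) @[n --> \oo] --> (0 : R).
  by have /fine_cvgP[_] := PF.
apply: (@squeeze_cvgr _ _ _ _ (fun=> 0) (fun n => pr P (\bigcup_(k >= n) F k))) => //.
- near=> n; rewrite pr_ge0/=; apply: pr_le.
  + exact: mF.
  + exact: bigcup_measurable.
  + by move=> w Fw; exists n => /=.
- exact: cvg_cst.
Unshelve. all: by end_near. Qed.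

End ae_to_probability.

(** * Weighted sums under the strong invariance principle *)

Section transfer.
Context d d' (T : measurableType d) (T' : measurableType d') (R : realType)
  (P : probability T R) (P' : probability T' R).
Variables (X : nat -> T -> R) (X' : nat -> T' -> R).
Hypothesis XX' : same_law P P' X X'.

Lemma same_law_pr n (F : n.-tuple R -> R) (B : set R) :
  measurable_fun setT F -> measurable B ->
  pr P [set w | B (F [tuple X i.+1 w | i < n])]
  = pr P' [set w | B (F [tuple X' i.+1 w | i < n])].
Proof.
move=> mF mB; rewrite /pr; congr fine.
apply: (XX' (A := F @^-1` B)).
by rewrite -[X in measurable X]setTI; exact: mF.
Qed.

(** Events about the weighted sum [\sum c_i g(X_i)] have the same probability
    for [X] and for its copy. *)
Lemma same_law_wsum n (c : nat -> R) (g : R -> R) (B : set R) :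
  measurable_fun setT g -> measurable B ->
  pr P [set w | B (\sum_(i < n) c i * g (X i.+1 w))]
  = pr P' [set w | B (\sum_(i < n) c i * g (X' i.+1 w))].
Proof.
move=> mg mB.
have mF : measurable_fun setT (fun t : n.-tuple R => \sum_(i < n) c i * g (tnth t i)).
  apply: measurable_sum => i; apply: measurable_funM => //.
  by apply: (measurableT_comp mg); exact: measurable_tnth.
have := @same_law_pr n _ B mF mB.
under eq_set do under eq_bigr do rewrite tnth_mktuple.
by under [X in _ = pr _ X -> _]eq_set do under eq_bigr do rewrite tnth_mktuple.
Qed.

End transfer.

Section abel.
Context (R : realType).
Implicit Types (s S : nat -> R).

Lemma sum1E (F : nat -> R) n : \sum_(1 <= i < n.+1) F i = \sum_(i < n) F i.+1.
Proof. by rewrite big_add1/= big_mkord. Qed.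

Lemma abel_summation s S n : S 0%N = 0 ->
  \sum_(i < n.+1) s i.+1 * (S i.+1 - S i)
  = s n.+1 * S n.+1 - \sum_(i < n) (s i.+2 - s i.+1) * S i.+1.
Proof.
move=> S0; elim: n => [|n IH]; first by rewrite big_ord1 big_ord0 S0 !subr0.
by rewrite big_ord_recr IH/= [in RHS]big_ord_recr/=; ring.
Qed.

Lemma abel_bound s S n M : S 0%N = 0 ->
  (forall i, (1 <= i <= n)%N -> `|S i| <= M) -> (0 < n)%N ->
  `|\sum_(i < n) s i.+1 * (S i.+1 - S i)|
  <= (`|s n| + \sum_(2 <= i < n.+1) `|s i - s i.-1|) * M.
Proof.
case: n => // n S0 SM _; rewrite abel_summation// mulrDl.
apply: le_trans (ler_normB _ _) _; apply: lerD.
  by rewrite normrM ler_wpM2l// SM// leqnn.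
rewrite big_add1/= big_add1/= big_mkord mulr_suml.
apply: le_trans (ler_norm_sum _ _ _) _; apply: ler_sum => i _.
by rewrite normrM ler_wpM2l// SM//= ltnS ltnW.
Qed.

End abel.

Lemma Delta_gt0 (R : realType) n : (1 < n)%N -> 0 < Delta R n.
Proof.
move=> n1; rewrite /Delta mulr_gt0 ?powR_gt0 ?ln_gt0 ?ltr1n ?ltr0n//.
exact: ltn_trans n1.
Qed.

Section brownian.
Context d (T : measurableType d) (R : realType) (P : probability T R)
  (B : R -> {RV P >-> R}).
Hypothesis BM : standard_brownian_motion B.

Definition increment i w := B i.+1%:R w - B i%:R w.

Lemma measurable_increment i : measurable_fun setT (increment i).
Proof. exact: measurable_funB. Qed.

Lemma brownian_noise n : standardized_noise P increment n 4.
Proof.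
have [_ law ind _] := BM.
have mI := measurable_increment.
split => // [|i _].
  apply: (ind n (fun i => i%:R)) => // i.
  by rewrite ler_nat.
have lawi (A : set R) : measurable A -> P [set w | A (increment i w)]
  = normal_prob 0 1 A.
  move=> mA; have := law i%:R i.+1%:R (ler0n _ _) _ A mA.
  rewrite (_ : i.+1%:R - i%:R = 1); last by rewrite -natr1; ring.
  by rewrite sqrtr1; apply; rewrite ltr_nat.
split.
- exact: std_normal_mean lawi.
- exact: std_normal_integ_sqr lawi.
- exact: std_normal_second_moment lawi.
- exact: std_normal_integ_norm3 lawi.
- exact: std_normal_third_moment lawi.
Qed.

End brownian.

Section invariance.
Context d (T : measurableType d) (R : realType) (P : probability T R)
  (X : nat -> {RV P >-> R}) (B : R -> {RV P >-> R}) (g : R -> R) (tau : R).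
Hypothesis mg : measurable_fun setT g.
Hypothesis BM : standard_brownian_motion B.

Let S i w := \sum_(1 <= j < i.+1) g (X j w) - tau * B i%:R w.
Let maxS n w := \big[Num.max/0]_(1 <= i < n.+1) `|S i w|.
Hypothesis SIP : {ae P, forall w, maxS n w / Delta R n @[n --> \oo] --> (0 : R)}.

Variables (s : nat -> nat -> R) (c : nat -> R).
Let V n := `|s n n| + \sum_(2 <= i < n.+1) `|s n i - s n i.-1|.
Hypothesis c0 : forall n, (0 < n)%N -> 0 < c n.
Hypothesis Vc : V n * Delta R n / c n @[n --> \oo] --> (0 : R).

Definition sip_error n w := (\sum_(i < n) s n i.+1 * g (X i.+1 w)
  - tau * \sum_(i < n) s n i.+1 * increment B i w) / c n.

Lemma measurable_sip_error n : measurable_fun setT (sip_error n).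
Proof.
apply: measurable_funM => //; apply: measurable_funB.
  apply: measurable_sum => i; apply: measurable_funM => //.
  exact: (measurableT_comp mg).
apply: measurable_funM => //; apply: measurable_sum => i.
by apply: measurable_funM => //; exact: measurable_increment.
Qed.

(** Summation by parts turns the uniform bound on the partial sums into a bound
    on weighted sums, at the price of the variation of the weights. *)
Lemma sip_error_pr eta : 0 < eta ->
  pr P [set w | eta < `|sip_error n w|] @[n --> \oo] --> (0 : R).
Proof.
apply: ae_cvg0_pr; first exact: measurable_sip_error.
have [B0 _ _ _] := BM.
have fil : Filter (almost_everywhere P) := ae_filter_ringOfSetsType P.
apply: filterS2 B0 SIP => w B0w Sw.
have S0 : S 0 w = 0 by rewrite /S big_geq// B0w mulr0 subrr.
have lim0 : (V n * Delta R n / c n) * (maxS n w / Delta R n) @[n --> \oo] --> (0 : R).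
  by rewrite -(mulr0 0); exact: cvgM.
apply/norm_cvg0P; apply: (@squeeze_cvgr _ _ _ _ (fun=> 0) _ _ _ _ _ lim0);
  last exact: cvg_cst.
near=> n; rewrite normr_ge0/=.
have n1 : (1 < n)%N by near: n; exists 2%N.
have n0 : (0 < n)%N := ltnW n1.
have D0 := Delta_gt0 R n1.
have -> : V n * Delta R n / c n * (maxS n w / Delta R n) = V n * maxS n w / c n.
  by field; rewrite !gt_eqF// c0.
rewrite /sip_error normrM normfV (gtr0_norm (c0 n0)) ler_pM2r ?invr_gt0 ?c0//.
have -> : \sum_(i < n) s n i.+1 * g (X i.+1 w) - tau * \sum_(i < n) s n i.+1 * increment B i w
    = \sum_(i < n) s n i.+1 * (S i.+1 w - S i w).
  rewrite mulr_sumr -sumrB; apply: eq_bigr => i _.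
  by rewrite /S /increment big_nat_recr//=; ring.
apply: (@abel_bound R (s n) (fun i => S i w)) => // i i1n.
by apply: (@le_bigmax_seq _ _ _ _ _ i xpredT) => //; rewrite mem_index_iota ltnS.
Unshelve. all: by end_near. Qed.

End invariance.

Section weights.
Context (R : realType) (sigma : nat -> nat -> R).
Hypothesis sigma0 : forall n i : nat, (1 <= i <= n)%N -> 0 < sigma n i.

Lemma sum_powE p n : sum_pow sigma p n = \sum_(i < n) sigma n i.+1 ^+ p.
Proof. by rewrite /sum_pow sum1E. Qed.

Lemma sum_pow_gt0 p n : (0 < n)%N -> 0 < sum_pow sigma p n.
Proof.
case: n => // n _; rewrite sum_powE big_ord_recl/= ltr_pwDl ?exprn_gt0 ?sigma0//.
apply: sumr_ge0 => i _; rewrite exprn_ge0 ?ltW ?sigma0//=.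
by rewrite /bump/= add1n ltnS.
Qed.

Lemma Sigma_gt0 n : (0 < n)%N -> 0 < Sigma sigma n.
Proof. by move=> n0; rewrite sqrtr_gt0 sum_pow_gt0. Qed.

Lemma Sigma_sqr n : Sigma sigma n ^+ 2 = sum_pow sigma 2 n.
Proof.
by rewrite sqr_sqrtr// sum_powE; apply: sumr_ge0 => i _; exact: sqr_ge0.
Qed.

Lemma variation_pow_ge0 p n : 0 <= variation_pow sigma p n.
Proof. by rewrite addr_ge0// sumr_ge0. Qed.

Lemma Delta_ge0 n : (0 < n)%N -> 0 <= Delta R n.
Proof. by move=> n0; rewrite mulr_ge0 ?powR_ge0// ln_ge0// ler1n. Qed.

Hypothesis rate : variation_pow sigma 1 n * Delta R n / Sigma sigma n
    + (variation_pow sigma 2 n * Delta R n + Sigma_star2 sigma n)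
      / Sigma sigma n ^+ 2 @[n --> \oo] --> (0 : R).

Let rate_part (u : nat -> R) : (forall n, (0 < n)%N -> 0 <= u n
    <= variation_pow sigma 1 n * Delta R n / Sigma sigma n
    + (variation_pow sigma 2 n * Delta R n + Sigma_star2 sigma n)
      / Sigma sigma n ^+ 2) -> u n @[n --> \oo] --> (0 : R).
Proof.
move=> uP; apply: (@squeeze_cvgr _ _ _ _ (fun=> 0) _ _ _ _ _ rate);
  last exact: cvg_cst.
by near=> n; apply: uP; near: n; exists 1%N.
Unshelve. all: by end_near. Qed.

Let p1 n : (0 < n)%N -> 0 <= variation_pow sigma 1 n * Delta R n / Sigma sigma n.
Proof. by move=> n0; apply: divr_ge0 (sqrtr_ge0 _);
  exact: mulr_ge0 (variation_pow_ge0 _ _) (Delta_ge0 n0). Qed.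

Let p2 n : (0 < n)%N -> 0 <= variation_pow sigma 2 n * Delta R n / Sigma sigma n ^+ 2.
Proof. by move=> n0; apply: divr_ge0 (sqr_ge0 _);
  exact: mulr_ge0 (variation_pow_ge0 _ _) (Delta_ge0 n0). Qed.

Let p3 n : 0 <= Sigma_star2 sigma n / Sigma sigma n ^+ 2.
Proof. exact: divr_ge0 (sqrtr_ge0 _) (sqr_ge0 _). Qed.

Lemma rate1 : variation_pow sigma 1 n * Delta R n / Sigma sigma n
  @[n --> \oo] --> (0 : R).
Proof.
apply: rate_part => n n0; have := p1 n0; have := p2 n0; have := p3 n.
rewrite [(_ + Sigma_star2 _ _) / _]mulrDl => *; apply/andP; split; lra.
Qed.

Lemma rate2 : variation_pow sigma 2 n * Delta R n / Sigma sigma n ^+ 2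
  @[n --> \oo] --> (0 : R).
Proof.
apply: rate_part => n n0; have := p1 n0; have := p2 n0; have := p3 n.
rewrite [(_ + Sigma_star2 _ _) / _]mulrDl => *; apply/andP; split; lra.
Qed.

Lemma rate3 : Sigma_star2 sigma n / Sigma sigma n ^+ 2 @[n --> \oo] --> (0 : R).
Proof.
apply: rate_part => n n0; have := p1 n0; have := p2 n0; have := p3 n.
rewrite [(_ + Sigma_star2 _ _) / _]mulrDl => *; apply/andP; split; lra.
Qed.

Hypothesis lyapunov : sum_pow sigma 3 n ^+ 2 * sum_pow sigma 2 n ^- 3
  @[n --> \oo] --> (0 : R).

Lemma lyapunov_ratio : sum_pow sigma 3 n / Sigma sigma n ^+ 3
  @[n --> \oo] --> (0 : R).
Proof.
apply/cvgr0Pnorm_lt => eps eps0.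
have /cvgr0_norm_lt/(_ _ (exprn_gt0 2 eps0)) := lyapunov.
apply: filter_app; near=> n.
have n0 : (0 < n)%N by near: n; exists 1%N.
have -> : sum_pow sigma 3 n ^+ 2 * sum_pow sigma 2 n ^- 3
    = `|sum_pow sigma 3 n / Sigma sigma n ^+ 3| ^+ 2.
  rewrite real_normK ?num_real// -Sigma_sqr; field.
  by rewrite gt_eqF ?Sigma_gt0.
by rewrite normrX normr_id ltr_pXn2r ?nnegrE// ltW.
Unshelve. all: by end_near. Qed.

End weights.

Lemma cvg_le_eventually (R : realType) (u : nat -> R) (eps : R) :
  u n @[n --> \oo] --> (0 : R) -> 0 < eps -> \forall n \near \oo, u n <= eps.
Proof.
move=> u0 e0; have /cvgr0_norm_lt/(_ _ e0) := u0.
by apply: filterS => n /ltW; exact: le_trans (ler_norm _).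
Qed.

Section numerator.
Context d (T : measurableType d) (R : realType) (P : probability T R)
  (e : nat -> {RV P >-> R}) (sigma : nat -> nat -> R) (tau tau_star : R).
Hypothesis sigma0 : forall n i : nat, (1 <= i <= n)%N -> 0 < sigma n i.
Hypothesis rate : variation_pow sigma 1 n * Delta R n / Sigma sigma n
    + (variation_pow sigma 2 n * Delta R n + Sigma_star2 sigma n)
      / Sigma sigma n ^+ 2 @[n --> \oo] --> (0 : R).
Hypothesis lyapunov : sum_pow sigma 3 n ^+ 2 * sum_pow sigma 2 n ^- 3
  @[n --> \oo] --> (0 : R).
Hypothesis tau0 : 0 < tau.

(** On the copy carrying the Brownian motion the normalized sum is a weighted sum
    of independent normal increments plus a negligible error. The weights
    [sigma_i / Sigma_n] have square sum one and vanishing cube sum, so that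
    Lyapunov's theorem gives the limit and the convolution of normal laws is
    avoided. *)
Lemma numerator_clt (x eps : R) : strong_invariance e (fun x => x) tau (Delta R) ->
  0 < eps -> \forall n \near \oo,
  `|pr P [set w | \sum_(i < n) (sigma n i.+1 / (tau * Sigma sigma n)) * e i.+1 w <= x]
    - Phi x| <= eps.
Proof.
case=> d' [T' [P' [X' [B [same BM SIP]]]]] eps0.
have [eta [y1 [y2 [eta0 slut]]]] := slutsky x eps0.
have M0 : (0 : R) <= 4 by [].
have [k1 k10 clt1] := @lyapunov_clt R y1 eta 4 eta0 M0.
have [k2 k20 clt2] := @lyapunov_clt R y2 eta 4 eta0 M0.
pose c n := tau * Sigma sigma n.
have c0 n : (0 < n)%N -> 0 < c n by move=> n0; rewrite mulr_gt0 ?Sigma_gt0.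
have Vc : (`|sigma n n| + \sum_(2 <= i < n.+1) `|sigma n i - sigma n i.-1|)
    * Delta R n / c n @[n --> \oo] --> (0 : R).
  have lim : tau^-1 * (variation_pow sigma 1 n * Delta R n / Sigma sigma n)
      @[n --> \oo] --> tau^-1 * 0 by apply: cvgM; [exact: cvg_cst|exact: rate1].
  rewrite mulr0 in lim; apply: cvg_trans lim; apply: near_eq_cvg.
  apply: nearW => n /=; rewrite /c /variation_pow expr1 invfM.
  under [in LHS]eq_bigr do rewrite !expr1.
  by ring.
pose E n := sip_error X' B (fun x => x) tau sigma c n.
have mE n : measurable_fun setT (E n) by exact: measurable_sip_error.
have prE := @sip_error_pr _ _ _ P' X' B (fun x => x) tau (@measurable_id _ _ _) BM SIP sigma c c0 Vc eta eta0.
near=> n.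
have n0 : (0 < n)%N by near: n; exists 1%N.
have S0 := Sigma_gt0 sigma0 n0.
have ratio : sum_pow sigma 3 n / Sigma sigma n ^+ 3 <= Num.min k1 k2.
  by near: n; apply: cvg_le_eventually; [exact: lyapunov_ratio|rewrite lt_min k10].
have mhalf : measurable [set y : R | y <= x] by exact: measurable_le_set.
rewrite (same_law_wsum same n (fun i => sigma n i.+1 / c n) (g := idfun)
  (@measurable_id _ _ _) mhalf).
pose a i := sigma n i.+1 / Sigma sigma n.
have a2 : \sum_(i < n) a i ^+ 2 = 1.
  under eq_bigr do rewrite /a exprMn exprVn.
  by rewrite -mulr_suml -sum_powE Sigma_sqr divff// gt_eqF// sum_pow_gt0.
have a3 : \sum_(i < n) `|a i| ^+ 3 <= Num.min k1 k2.
  apply: le_trans ratio.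
  rewrite sum_powE mulr_suml; apply: ler_sum => i _.
  have a0 : 0 <= a i by rewrite divr_ge0 ?(ltW S0)// ltW// sigma0/=.
  by rewrite (ger0_norm a0) exprMn exprVn.
have noise := brownian_noise BM n.
have mI := measurable_increment B.
apply: (slut _ _ _ (wsum (increment B) a n) (fun=> 1) (E n)).
- exact: measurable_wsum.
- exact: measurable_cst.
- exact: mE.
- by apply: measurable_sum => i; exact: measurable_funM.
- move=> w _; rewrite mulr1 /E /sip_error /wsum mulrBl mulr_suml.
  rewrite [X in _ = X + _](_ : _
    = (tau * \sum_(i < n) sigma n i.+1 * increment B i w) / c n).
    by rewrite addrC subrK; apply: eq_bigr => i _; rewrite mulrAC.
  rewrite mulr_sumr mulr_suml; apply: eq_bigr => i _.
  by rewrite /a /c; field; rewrite !gt_eqF.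
- by apply: clt1 => //; apply: le_trans a3 _; rewrite ge_min lexx.
- by apply: clt2 => //; apply: le_trans a3 _; rewrite ge_min lexx orbT.
- rewrite (_ : [set w | _] = set0) ?/pr ?measure0//= ?ltW//.
  by apply/seteqP; split => // w /=; rewrite subrr normr0 ltNge ltW.
- by near: n; apply: cvg_le_eventually.
Unshelve. all: by end_near. Qed.

Let sqr1 (t : R) := t ^+ 2 - 1.

Lemma measurable_sqr1 : measurable_fun setT sqr1.
Proof. by apply: measurable_funB => //; exact: measurable_funX. Qed.

(** The weighted sum of the [e_i ^+ 2 - 1] is the approximation error plus a
    Brownian part, whose variance is [tau_star ^+ 2] times the square of
    [Sigma_star2 / Sigma ^+ 2]. *)
Lemma denominator_pr (eta : R) : 0 <= tau_star ->
  strong_invariance e (fun x => x ^+ 2 - 1) tau_star (Delta R) -> 0 < eta ->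
  pr P [set w | eta < `|\sum_(i < n) (sigma n i.+1 ^+ 2 / Sigma sigma n ^+ 2) * (e i.+1 w ^+ 2 - 1)|]
    @[n --> \oo] --> (0 : R).
Proof.
move=> ts0 [d' [T' [P' [X' [B [same BM SIP]]]]]] eta0.
pose c n := Sigma sigma n ^+ 2.
have c0 n : (0 < n)%N -> 0 < c n by move=> n0; rewrite exprn_gt0 ?Sigma_gt0.
have eta2 : 0 < eta / 2 by rewrite divr_gt0.
have prE := @sip_error_pr _ _ _ P' X' B sqr1 tau_star measurable_sqr1 BM SIP
  (fun n i => sigma n i ^+ 2) c c0 (rate2 rate) (eta / 2) eta2.
pose E n := sip_error X' B sqr1 tau_star (fun n i => sigma n i ^+ 2) c n.
have mE n : measurable_fun setT (E n).
  by apply: measurable_sip_error; exact: measurable_sqr1.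
have mI := measurable_increment B.
pose a n i := tau_star * (sigma n i.+1 ^+ 2 / c n).
pose G n w := wsum (increment B) (a n) n w.
have mG n : measurable_fun setT (G n) by exact: measurable_wsum.
have bound : ((eta / 2) ^+ 2)^-1 * (tau_star ^+ 2 * (Sigma_star2 sigma n / Sigma sigma n ^+ 2) ^+ 2)
    @[n --> \oo] --> (0 : R).
  rewrite -[X in _ --> X](mulr0 ((eta / 2) ^+ 2)^-1).
  apply: cvgM; first exact: cvg_cst.
  rewrite -[X in _ --> X](mulr0 (tau_star ^+ 2)).
  apply: cvgM; first exact: cvg_cst.
  by have h := cvgM (rate3 rate) (rate3 rate); rewrite mulr0 in h; exact: h.
apply: (@squeeze_cvgr _ _ _ _ (fun=> 0) (fun n => pr P' [set w | eta / 2 < `|E n w|]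
  + ((eta / 2) ^+ 2)^-1 * (tau_star ^+ 2 * (Sigma_star2 sigma n / Sigma sigma n ^+ 2) ^+ 2))).
- near=> n; rewrite pr_ge0/=.
  have n0 : (0 < n)%N by near: n; exists 1%N.
  have mB : measurable [set y : R | eta < `|y|].
    by apply: measurable_lt_set => //; exact: measurable_fun_norm.
  rewrite (same_law_wsum same n (fun i => sigma n i.+1 ^+ 2 / c n) measurable_sqr1 mB).
  have noise := brownian_noise BM n; have [_ indI nI] := noise.
  have [iG EG] := @second_moment_wsum _ _ _ P' (increment B) n mI indI
    (fun i ni => let: And5 _ h _ _ _ := nI i ni in h)
    (fun i ni => let: And5 h _ _ _ _ := nI i ni in h) (a n) n (leqnn n).
  apply: le_trans (pr_leU (B := [set w | eta / 2 < `|E n w|]) (C := [set w | eta / 2 < `|G n w|]) _ _ _ _ _) _.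
  + apply: measurable_lt_set => //; apply: measurable_fun_norm.
    apply: measurable_sum => i; apply: measurable_funM => //.
    exact: (measurableT_comp measurable_sqr1).
  + by apply: measurable_lt_set => //; exact: measurable_fun_norm.
  + by apply: measurable_lt_set => //; exact: measurable_fun_norm.
  + move=> w /=.
    have -> : \sum_(i < n) sigma n i.+1 ^+ 2 / c n * sqr1 (X' i.+1 w) = E n w + G n w.
      rewrite /E /sip_error mulrBl [X in _ - X](_ : _ = G n w) ?subrK.
        by rewrite mulr_suml; apply: eq_bigr => i _; rewrite mulrAC.
      rewrite mulr_sumr mulr_suml; apply: eq_bigr => i _.
      by rewrite /a; ring.
    move=> h; apply/orP; rewrite -[X in X || _]negbK -implybE -leNgt.
    by apply/implyP => h1; have := ler_normD (E n w) (G n w); lra.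
  + rewrite lerD2l; apply: le_trans (pr_chebyshev (mG n) iG eta2) _.
    rewrite EG; apply: ler_wpM2l; first by rewrite invr_ge0 sqr_ge0.
    rewrite le_eqVlt; apply/orP; left; apply/eqP.
    rewrite (eq_bigr (fun i : 'I_n => tau_star ^+ 2 * c n ^- 2 * sigma n i.+1 ^+ 4)); last first.
      by move=> i _; have [_ _ -> _ _] := nI i (ltn_ord i); rewrite /a; field;
        rewrite gt_eqF ?c0.
    have S4 : Sigma_star2 sigma n ^+ 2 = sum_pow sigma 4 n.
      rewrite sqr_sqrtr// sum_powE sumr_ge0// => i _.
      by rewrite exprn_even_ge0.
    by rewrite -mulr_sumr -sum_powE -S4 -/(c n); field; rewrite gt_eqF ?c0.
- exact: cvg_cst.
- by rewrite -[X in _ --> X](addr0 0); apply: cvgD.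
Unshelve. all: by end_near. Qed.

End numerator.

(** * Self-normalized sums of the observations *)

Lemma norm_sqrt_sub1 (R : rcfType) (q : R) : 0 <= q -> `|Num.sqrt q - 1| <= `|q - 1|.
Proof.
move=> q0; rewrite -[in leRHS](sqr_sqrtr q0).
set s := Num.sqrt q; have s0 : 0 <= s by exact: sqrtr_ge0.
have -> : s ^+ 2 - 1 = (s - 1) * (s + 1) by ring.
by rewrite normrM ler_peMr// ger0_norm; lra.
Qed.

Lemma norm_mul_sub1 (R : realDomainType) (u v r : R) : 0 <= r -> r <= 1 -> `|u - 1| <= r ->
  `|v - 1| <= r -> `|u * v - 1| <= 3 * r.
Proof.
move=> r0 r1 h3 h4.
rewrite (_ : u * v - 1 = (u - 1) * (v - 1) + (u - 1) + (v - 1)); last by ring.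
apply: le_trans (ler_normD _ _) _; apply: le_trans (lerD (ler_normD _ _) (lexx _)) _.
rewrite normrM; have : `|u - 1| * `|v - 1| <= r * 1.
  by apply: ler_pM => //; exact: le_trans r1.
lra.
Qed.

Section studentized.
Context d (T : measurableType d) (R : realType) (P : probability T R)
  (e : nat -> {RV P >-> R}) (sigma : nat -> nat -> R) (tau : R)
  (tau_hat : nat -> {RV P >-> R}).
Hypothesis sigma0 : forall n i : nat, (1 <= i <= n)%N -> 0 < sigma n i.
Hypothesis tau0 : 0 < tau.
Hypothesis num : forall x eps : R, 0 < eps -> \forall n \near \oo,
  `|pr P [set w | \sum_(i < n) (sigma n i.+1 / (tau * Sigma sigma n)) * e i.+1 w <= x]
    - Phi x| <= eps.
Hypothesis den : forall eta : R, 0 < eta ->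
  pr P [set w | eta < `|\sum_(i < n) (sigma n i.+1 ^+ 2 / Sigma sigma n ^+ 2) * (e i.+1 w ^+ 2 - 1)|]
    @[n --> \oo] --> (0 : R).

Definition sum_sqr n w := \sum_(i < n) (sigma n i.+1 * e i.+1 w) ^+ 2.

Lemma measurable_sum_sqr n : measurable_fun setT (sum_sqr n).
Proof.
by apply: measurable_sum => i; apply: measurable_funX; exact: measurable_funM.
Qed.

Lemma sum_sqr_ge0 n w : 0 <= sum_sqr n w.
Proof. by apply: sumr_ge0 => i _; exact: sqr_ge0. Qed.

Lemma sum_sqrE n w : (0 < n)%N -> sum_sqr n w / Sigma sigma n ^+ 2 - 1
  = \sum_(i < n) (sigma n i.+1 ^+ 2 / Sigma sigma n ^+ 2) * (e i.+1 w ^+ 2 - 1).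
Proof.
move=> n0.
have sig1 : \sum_(i < n) sigma n i.+1 ^+ 2 / Sigma sigma n ^+ 2 = 1.
  by rewrite -mulr_suml -sum_powE Sigma_sqr divff// gt_eqF// sum_pow_gt0.
rewrite -[X in _ / _ - X = _]sig1 /sum_sqr mulr_suml -sumrB.
by apply: eq_bigr => i _; rewrite exprMn; ring.
Qed.

Lemma sum_sqr_pr (eta : R) : 0 < eta ->
  pr P [set w | eta < `|sum_sqr n w / Sigma sigma n ^+ 2 - 1|]
    @[n --> \oo] --> (0 : R).
Proof.
move=> eta0; apply: cvg_trans (den eta0); apply: near_eq_cvg.
near=> n; congr pr; apply: eq_set => w.
by rewrite sum_sqrE//; near: n; exists 1%N.
Unshelve. all: by end_near. Qed.

Lemma H_E n w : H sigma e n w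
  = (\sum_(i < n) sigma n i.+1 * e i.+1 w) / Num.sqrt (sum_sqr n w).
Proof.
rewrite /H !sum1E; congr (_ / Num.sqrt _).
by apply: eq_bigr => i _; rewrite exprMn.
Qed.

Lemma measurable_H n : measurable_fun setT (H sigma e n).
Proof.
rewrite (_ : H sigma e n = fun w => (\sum_(i < n) sigma n i.+1 * e i.+1 w)
  / Num.sqrt (sum_sqr n w)); last by apply/funext => w; exact: H_E.
apply: measurable_fun_div; last exact/measurable_fun_sqrt/measurable_sum_sqr.
by apply: measurable_sum => i; exact: measurable_funM.
Qed.

(** Slutsky: the statistic times [sqrt (sum_sqr / Sigma ^+ 2) * (tau_hat / tau)]
    is the normalized numerator, and this factor tends to one. *)
Lemma studentized_clt (x eps : R) : cvg_in_probability P tau_hat tau ->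
  0 < eps -> \forall n \near \oo,
  `|pr P [set w | H sigma e n w / tau_hat n w <= x] - Phi x| <= eps.
Proof.
move=> cons eps0.
have [eta [y1 [y2 [eta0 slut]]]] := slutsky x eps0.
pose r := Num.min 1 (eta / 3).
have r0 : 0 < r by rewrite lt_min ltr01 divr_gt0.
have r1 : r <= 1 by rewrite ge_min lexx.
have r3 : 3 * r <= eta by rewrite mulrC -ler_pdivlMr// ge_min lexx orbT.
have eta2 : 0 < eta / 2 by rewrite divr_gt0.
have rt : 0 < r * tau by rewrite mulr_gt0.
have prtau : pr P [set w | r * tau < `|tau_hat n w - tau|] @[n --> \oo] --> (0 : R).
  by have /fine_cvgP[] := cons _ rt.
pose Q n w := Num.sqrt (sum_sqr n w / Sigma sigma n ^+ 2) * (tau_hat n w / tau).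
have mS n : measurable_fun setT (fun w => sum_sqr n w / Sigma sigma n ^+ 2).
  by apply: measurable_funM => //; exact: measurable_sum_sqr.
have mQ n : measurable_fun setT (Q n).
  by apply: measurable_funM; [exact: measurable_fun_sqrt|exact: measurable_funM].
near=> n.
have n0 : (0 < n)%N by near: n; exists 1%N.
have S0 := Sigma_gt0 sigma0 n0.
apply: (slut _ _ _ (fun w => \sum_(i < n) (sigma n i.+1 / (tau * Sigma sigma n)) * e i.+1 w)
  (Q n) (fun=> 0)).
- by apply: measurable_sum => i; exact: measurable_funM.
- exact: mQ.
- exact: measurable_cst.
- by apply: measurable_fun_div => //; exact: measurable_H.
- move=> w Q0; rewrite addr0 H_E /Q sqrtrM ?sum_sqr_ge0// sqrtrV ?sqr_ge0// sqrtr_sqr gtr0_norm//.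
  have D0 : Num.sqrt (sum_sqr n w) != 0.
    apply/eqP => D0; move: Q0; rewrite /Q sqrtrM ?sum_sqr_ge0// D0 !mul0r.
    by rewrite ltxx.
  have t0 : tau_hat n w != 0.
    by apply/eqP => t0; move: Q0; rewrite /Q t0 mul0r mulr0 ltxx.
  rewrite [RHS](eq_bigr (fun i : 'I_n => (sigma n i.+1 * e i.+1 w) / (tau * Sigma sigma n))); last first.
    move=> i _; by rewrite mulrAC.
  by rewrite -mulr_suml; field; rewrite D0 t0 !gt_eqF.
- by near: n; exact: num.
- by near: n; exact: num.
- apply: (@le_trans _ _ (eta / 2 + eta / 2)); last by rewrite -splitr.
  apply: le_trans (lerD (_ : pr P [set w | r < `|sum_sqr n w / Sigma sigma n ^+ 2 - 1|] <= _)
    (_ : pr P [set w | r * tau < `|tau_hat n w - tau|] <= _)); last 2 first.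
  + by near: n; apply: cvg_le_eventually => //; exact: sum_sqr_pr.
  + by near: n; exact: cvg_le_eventually.
  apply: pr_leU.
  + by apply: measurable_lt_set => //; apply: measurable_fun_norm;
    exact: measurable_funB.
  + by apply: measurable_lt_set => //; apply: measurable_fun_norm;
    exact: measurable_funB.
  + by apply: measurable_lt_set => //; apply: measurable_fun_norm;
    exact: measurable_funB.
  move=> w /= Qw; apply/orP; rewrite -[X in X || _]negbK -implybE -leNgt.
  apply/implyP => h1; rewrite ltNge; apply/negP => h2.
  move: Qw; rewrite ltNge => /negP; apply; apply: le_trans r3; rewrite /Q.
  have q0 : 0 <= sum_sqr n w / Sigma sigma n ^+ 2.
    by rewrite divr_ge0 ?sum_sqr_ge0 ?sqr_ge0.
  have h3 := le_trans (norm_sqrt_sub1 q0) h1.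
  have h4 : `|tau_hat n w / tau - 1| <= r.
    rewrite (_ : _ - 1 = (tau_hat n w - tau) / tau); last by field; rewrite gt_eqF.
    by rewrite normrM normfV (gtr0_norm tau0) ler_pdivrMr.
  exact: norm_mul_sub1 (ltW r0) r1 h3 h4.
- rewrite (_ : [set w | _] = set0) ?/pr ?measure0//= ?ltW//.
  by apply/seteqP; split => // w /=; rewrite normr0 ltNge ltW.
Unshelve. all: by end_near. Qed.

End studentized.

(** * Self-normalized sums of independent multipliers *)

Section multipliers.
Context (R : realType).
Implicit Types (eta eps M : R).

(** A weak law of large numbers for [X_i ^+ 2] under a third moment only:
    the truncated part [Num.min (X_i ^+ 2) (L ^+ 2)] is handled by its
    variance and the rest, at most [`|X_i| ^+ 3 / L], by its mean. *)
Lemma weighted_sqr_wlln eta eps M : 0 < eta -> 0 < eps -> 0 <= M ->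
  exists2 kappa, 0 < kappa &
  forall d (T : measurableType d) (P : probability T R) (X : nat -> T -> R)
    (n : nat) (b : nat -> R),
  standardized_noise P X n M -> (forall i, 0 <= b i) ->
  \sum_(i < n) b i = 1 -> \sum_(i < n) b i ^+ 2 <= kappa ->
  pr P [set w | eta < `|\sum_(i < n) b i * (X i w ^+ 2 - 1)|] <= eps.
Proof.
move=> eta0 eps0 M0.
(* [L] makes the mean of the tail part at most [eta * eps / 4], and [kappa] makes
   the variance of the truncated part at most [(eta / 2) ^+ 2 * (eps / 2)]. *)
pose L := 8 * M / (eta * eps) + 1.
have ee0 : 0 < eta * eps by rewrite mulr_gt0.
have L0 : 0 < L by rewrite ltr_wpDl// divr_ge0 ?mulr_ge0// ltW.
have eta2 : 0 < eta / 2 by rewrite divr_gt0.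
pose kappa := (eps / 2) * ((eta / 2) ^+ 2 / L ^+ 4).
exists kappa; first by rewrite mulr_gt0 ?divr_gt0 ?exprn_gt0.
move=> d T P X n b [mX indX HX] b0 b1 b2.
pose trunc (t : R) := Num.min (t ^+ 2) (L ^+ 2).
pose tail (t : R) := t ^+ 2 - trunc t.
have mtrunc : measurable_fun setT trunc.
  by apply: measurable_minr => //; exact: measurable_funX.
have mtail : measurable_fun setT tail.
  by apply: measurable_funB => //; exact: measurable_funX.
have trunc0 t : 0 <= trunc t by rewrite le_min !sqr_ge0.
have truncL t : trunc t <= L ^+ 2 by rewrite ge_min lexx orbT.
have tail0 t : 0 <= tail t by rewrite subr_ge0 ge_min lexx.
have tail3 t : tail t <= L^-1 * `|t| ^+ 3.
  rewrite /tail /trunc; case: (leP (t ^+ 2) (L ^+ 2)) => tL.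
    by rewrite subrr mulr_ge0 ?invr_ge0 ?exprn_ge0// ltW.
  have Lt : L <= `|t|.
    rewrite leNgt; apply/negP => /ltW tL'; move: tL; rewrite ltNge => /negP; apply.
    by rewrite -(real_normK (num_real t)) lerXn2r ?nnegrE// ltW.
  apply: (@le_trans _ _ (t ^+ 2)); first by rewrite lerBlDr lerDl sqr_ge0.
  rewrite mulrC ler_pdivlMr// [leRHS]exprSr real_normK ?num_real//.
  by rewrite ler_wpM2l ?sqr_ge0.
have iTr i : integ P (fun w => trunc (X i w)).
  apply: (@integ_bounded _ _ _ P _ (L ^+ 2)).
    exact: (measurableT_comp mtrunc).
  by move=> w; rewrite ger0_norm.
have iTa i : (i < n)%N -> integ P (fun w => tail (X i w)).
  by move=> /HX[_ h _ _ _]; exact: integB.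
pose c i := \int[P]_w trunc (X i w).
have cL i : 0 <= c i <= L ^+ 2.
  apply/andP; split; first by apply: Rintegral_ge0.
  rewrite -[leRHS](Rintegral_cst_prob P); apply: Rintegral_le => //.
  exact: integ_cst.
have cE i : (i < n)%N -> 1 - c i = \int[P]_w tail (X i w).
  by move=> /[dup] ni /HX[_ h <- _ _]; rewrite -RintegralB.
have cM i : (i < n)%N -> \int[P]_w tail (X i w) <= L^-1 * M.
  move=> /[dup] ni /HX[_ _ _ h3 h3M].
  apply: (@le_trans _ _ (\int[P]_w (L^-1 * `|X i w| ^+ 3))).
    by apply: Rintegral_le => //; [exact: iTa|exact: integZ].
  by rewrite RintegralZl// ler_wpM2l// invr_ge0 ltW.
pose Y i w := trunc (X i w) - c i.
have mY i : measurable_fun setT (Y i).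
  by apply: measurable_funB => //; exact: (measurableT_comp mtrunc).
have indY : mutually_independent P (fun i : 'I_n => Y i).
  apply: (@mutually_independent_comp _ _ _ P 'I_n (fun i => X i) (fun i t => trunc t - c i)) => //.
  by move=> i; exact: measurable_funB.
have Ybound i w : `|Y i w ^+ 2| <= L ^+ 4.
  have := cL i; have := trunc0 (X i w); have := truncL (X i w).
  rewrite ger0_norm ?sqr_ge0// /Y => h1 h2 /andP[h3 h4].
  rewrite (_ : L ^+ 4 = (L ^+ 2) ^+ 2); last by rewrite -exprM.
  by rewrite -(real_normK (num_real (_ - _))) lerXn2r ?nnegrE ?sqr_ge0// ler_norml;
    apply/andP; split; lra.
have iY2 i : integ P (fun w => Y i w ^+ 2).
  apply: (@integ_bounded _ _ _ P _ (L ^+ 4)); first exact: measurable_funX.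
  exact: Ybound.
have EY i : \int[P]_w Y i w = 0.
  by rewrite RintegralB ?Rintegral_cst_prob ?subrr//; exact: integ_cst.
have [iS ES] := @second_moment_wsum _ _ _ P Y n mY indY (fun i _ => iY2 i)
  (fun i _ => EY i) b n (leqnn n).
pose V w := \sum_(i < n) b i * (tail (X i w) + (1 - c i)).
have iVi (i : 'I_n) : integ P (fun w => b i * (tail (X i w) + (1 - c i))).
  by apply: integZ; apply: integD; [exact: iTa|exact: integ_cst].
have iV : integ P V by exact: integ_sum.
have c1 i : (i < n)%N -> 0 <= 1 - c i.
  by move=> ni; rewrite cE//; apply: Rintegral_ge0.
have V0 w : 0 <= V w.
  by apply: sumr_ge0 => i _; rewrite mulr_ge0// addr_ge0// c1.
have EV : \int[P]_w V w <= 2 * (L^-1 * M).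
  rewrite Rintegral_sum_prob//.
  rewrite -[leRHS]mul1r -[X in _ <= X * _]b1 mulr_suml; apply: ler_sum => i _.
  have iti := iTa i (ltn_ord i).
  rewrite RintegralZl//; last by apply: integD => //; exact: integ_cst.
  apply: ler_wpM2l => //; rewrite RintegralD//; last exact: integ_cst.
  by rewrite Rintegral_cst_prob cE//; have := cM i (ltn_ord i); lra.
have mS := measurable_wsum mY b n.
have mV := integ_measurable iV.
apply: le_trans (pr_leU (B := [set w | eta / 2 < `|wsum Y b n w|])
  (C := [set w | eta / 2 <= V w]) _ _ _ _ _) _.
- apply: measurable_lt_set => //; apply: measurable_fun_norm.
  apply: measurable_sum => i; apply: measurable_funM => //.
  by apply: measurable_funB => //; exact: measurable_funX.
- by apply: measurable_lt_set => //; exact: measurable_fun_norm.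
- exact: measurable_le_set.
- move=> w /= h.
  have [h1|h1] := ltP (eta / 2) `|wsum Y b n w|; [by left|right].
  have h2 : `|\sum_(i < n) b i * (X i w ^+ 2 - 1)| <= `|wsum Y b n w| + V w.
    have -> : \sum_(i < n) b i * (X i w ^+ 2 - 1)
        = wsum Y b n w + \sum_(i < n) b i * (tail (X i w) - (1 - c i)).
      rewrite /wsum -big_split/=; apply: eq_bigr => i _.
      by rewrite /Y /tail; ring.
    apply: le_trans (ler_normD _ _) _; rewrite lerD2l.
    apply: le_trans (ler_norm_sum _ _ _) _; apply: ler_sum => i _.
    rewrite normrM (ger0_norm (b0 i)); apply: ler_wpM2l => //.
    apply: le_trans (ler_normB _ _) _.
    by rewrite !ger0_norm ?tail0 ?c1.
  by rewrite /=; lra.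
rewrite [leRHS](splitr eps); apply: lerD.
  apply: le_trans (pr_chebyshev mS iS eta2) _.
  rewrite ES mulrC ler_pdivrMr ?exprn_gt0//.
  apply: (@le_trans _ _ (\sum_(i < n) b i ^+ 2 * L ^+ 4)).
    apply: ler_sum => i _; apply: ler_wpM2l; first exact: sqr_ge0.
    rewrite -[leRHS](Rintegral_cst_prob P); apply: Rintegral_le => //.
      exact: integ_cst.
    by move=> w; apply: le_trans (ler_norm _) (Ybound i w).
  rewrite -mulr_suml; apply: le_trans (ler_wpM2r _ b2) _.
    by rewrite exprn_ge0// ltW.
  by rewrite /kappa mulrA divfK// gt_eqF// exprn_gt0.
apply: le_trans (pr_markov iV V0 eta2) _.
rewrite mulrC ler_pdivrMr//; apply: le_trans EV _.
rewrite -(ler_pM2l L0) (_ : L * _ = 2 * M); last by field; rewrite gt_eqF.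
have : 8 * M <= L * (eta * eps).
  rewrite (_ : L * (eta * eps) = 8 * M + eta * eps) ?lerDl ?(ltW ee0)//.
  by rewrite /L; field; rewrite !gt_eqF.
lra.
Qed.

End multipliers.

(** Student's statistic, up to the factor [sqrt ((n - 1) / n)]. *)
Definition tstat (R : realType) (n : nat) (x : nat -> R) : R :=
  (\sum_(i < n) x i)
  / Num.sqrt (\sum_(i < n) (x i - (\sum_(j < n) x j) / n%:R) ^+ 2).

Lemma sum_sqr_center (R : realType) (n : nat) (x : nat -> R) : (0 < n)%N ->
  \sum_(i < n) (x i - (\sum_(j < n) x j) / n%:R) ^+ 2
  = \sum_(i < n) x i ^+ 2 - (\sum_(j < n) x j) ^+ 2 / n%:R.
Proof.
move=> n0; have nn : n%:R != 0 :> R by rewrite pnatr_eq0 -lt0n.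
set m := \sum_(j < n) x j.
rewrite (eq_bigr (fun i : 'I_n =>
  x i ^+ 2 + (- (2 * (m / n%:R))) * x i + (m / n%:R) ^+ 2)); last first.
  by move=> i _; ring.
rewrite !big_split/= -mulr_sumr sumr_const card_ord -mulr_natr -/m.
by field.
Qed.

Lemma measurable_tstat d (T : measurableType d) (R : realType) n (x : nat -> T -> R) :
  (forall i : 'I_n, measurable_fun setT (x i)) ->
  measurable_fun setT (fun w => tstat n (x^~ w)).
Proof.
move=> mx; have mS : measurable_fun setT (fun w => \sum_(i < n) x i w).
  exact: measurable_sum.
apply: measurable_fun_div => //; apply: measurable_fun_sqrt.
apply: measurable_sum => i; apply: measurable_funX; apply: measurable_funB => //.
exact: measurable_funM.
Qed.

(** The conditional limit law, stated for fixed weights [s] and uniformly in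
    them, so that it can be applied to the weights [sigma_i e_i] frozen at
    their observed values. *)
Lemma multiplier_clt (R : realType) (x eps M : R) : 0 < eps -> 0 <= M ->
  exists2 kappa, 0 < kappa &
  forall d (T : measurableType d) (P : probability T R) (X : nat -> T -> R)
    (n : nat) (s : nat -> R),
  standardized_noise P X n M -> (0 < n)%N -> n%:R^-1 <= kappa ->
  0 < \sum_(i < n) s i ^+ 2 ->
  \sum_(i < n) `|s i| ^+ 3 <= kappa * Num.sqrt (\sum_(i < n) s i ^+ 2) ^+ 3 ->
  `|pr P [set w | tstat n (fun i => s i * X i w) <= x] - Phi x| <= eps.
Proof.
move=> eps0 M0.
have [eta [y1 [y2 [eta0 slut]]]] := slutsky x eps0.
have eta2 : 0 < eta / 2 by rewrite divr_gt0.
have [k1 k10 clt1] := lyapunov_clt y1 eta0 M0.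
have [k2 k20 clt2] := lyapunov_clt y2 eta0 M0.
have [k3 k30 wlln] := weighted_sqr_wlln eta2 eta2 M0.
pose kappa := Num.min (Num.min k1 k2) (Num.min k3 ((eta / 2) ^+ 2)).
exists kappa; first by rewrite !lt_min k10 k20 k30 exprn_gt0.
have kP r : r <= kappa -> [/\ r <= k1, r <= k2, r <= k3 & r <= (eta / 2) ^+ 2].
  by rewrite !le_min => /andP[/andP[-> ->] /andP[-> ->]].
move=> d T P X n s noise n0 nk D20 s3.
have [mX indX HX] := noise.
have [_ _ _ nk4] := kP _ nk.
set D2 := \sum_(i < n) s i ^+ 2 in D20 s3; pose D := Num.sqrt D2.
have D0 : 0 < D by rewrite sqrtr_gt0.
have DD : D ^+ 2 = D2 by rewrite sqr_sqrtr// ltW.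
have nn : n%:R != 0 :> R by rewrite pnatr_eq0 -lt0n.
have nn0 : 0 < n%:R :> R by rewrite ltr0n.
pose a i := s i / D.
have a2 : \sum_(i < n) a i ^+ 2 = 1.
  under eq_bigr do rewrite exprMn exprVn DD.
  by rewrite -mulr_suml divff// gt_eqF.
have a3 : \sum_(i < n) `|a i| ^+ 3 <= kappa.
  under eq_bigr do rewrite normrM normfV (gtr0_norm D0) exprMn exprVn.
  by rewrite -mulr_suml ler_pdivrMr// exprn_gt0.
have [a31 a32 a33 _] := kP _ a3.
have a4 : \sum_(i < n) (a i ^+ 2) ^+ 2 <= k3.
  apply: le_trans a33; apply: ler_sum => i _.
  have a1 : `|a i| <= 1.
    rewrite -(@ler_pXn2r _ 2) ?nnegrE// expr1n (real_normK (num_real _)) -a2.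
    by rewrite (bigD1 i)//= lerDl sumr_ge0// => j _; exact: sqr_ge0.
  rewrite -(real_normK (num_real (a i))) -exprM [leLHS]exprS.
  by rewrite ler_piMl// exprn_ge0.
pose Z w := wsum X a n w.
have mZ : measurable_fun setT Z by exact: measurable_wsum.
pose V w := \sum_(i < n) (s i * X i w - (\sum_(j < n) s j * X j w) / n%:R) ^+ 2.
have sX w : \sum_(i < n) s i * X i w = D * Z w.
  rewrite /Z /wsum mulr_sumr; apply: eq_bigr => i _.
  by rewrite /a mulrA mulrCA divff ?mulr1 ?gt_eqF.
(* Centering at the sample mean costs [Z ^+ 2 / n], of mean [1 / n]. *)
have VE w : V w / D2 - 1
  = \sum_(i < n) a i ^+ 2 * (X i w ^+ 2 - 1) - n%:R^-1 * Z w ^+ 2.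
  rewrite /V (sum_sqr_center (fun i => s i * X i w) n0) sX.
  rewrite -[X in _ - X = _]a2 mulrBl mulr_suml.
  have -> : (D * Z w) ^+ 2 / n%:R / D2 = n%:R^-1 * Z w ^+ 2.
    by rewrite -DD; field; rewrite nn gt_eqF.
  rewrite addrAC -sumrB; congr (_ - _); apply: eq_bigr => i _.
  by rewrite /a -DD; field; rewrite gt_eqF.
have mV : measurable_fun setT V.
  apply: measurable_sum => i; apply: measurable_funX; apply: measurable_funB.
    exact: measurable_funM.
  apply: measurable_funM => //; apply: measurable_sum => j; exact: measurable_funM.
pose Q w := Num.sqrt (V w / D2).
have V0 w : 0 <= V w by apply: sumr_ge0 => i _; exact: sqr_ge0.
have mVD : measurable_fun setT (fun w => V w / D2) by exact: measurable_funM.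
apply: (slut _ _ _ Z Q (fun=> 0)).
- exact: mZ.
- exact: measurable_fun_sqrt.
- exact: measurable_cst.
- by apply: measurable_tstat => i; exact: measurable_funM.
- move=> w; rewrite addr0 /Q /tstat -/(V w) sX sqrtrM// sqrtrV ?(ltW D20)// -/D => Q0.
  have SV0 : Num.sqrt (V w) != 0.
    by apply/eqP => SV; move: Q0; rewrite SV mul0r ltxx.
  by field; rewrite SV0 gt_eqF.
- exact: clt1.
- exact: clt2.
- have Zn0 w : 0 <= n%:R^-1 * Z w ^+ 2.
    by apply: mulr_ge0 (sqr_ge0 _); rewrite invr_ge0.
  have [iZ EZ] := @second_moment_wsum _ _ _ P X n mX indX
    (fun i ni => let: And5 _ h _ _ _ := HX i ni in h)
    (fun i ni => let: And5 h _ _ _ _ := HX i ni in h) a n (leqnn n).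
  have EZ1 : \int[P]_w (Z w ^+ 2) = 1.
    rewrite EZ -[RHS]a2; apply: eq_bigr => i _.
    by have [_ _ -> _ _] := HX i (ltn_ord i); rewrite mulr1.
  apply: le_trans (pr_leU (B := [set w | eta / 2 < `|\sum_(i < n) a i ^+ 2 * (X i w ^+ 2 - 1)|])
    (C := [set w | eta / 2 <= n%:R^-1 * Z w ^+ 2]) _ _ _ _ _) _.
  + apply: measurable_lt_set => //; apply: measurable_fun_norm.
    by apply: measurable_funB => //; exact: measurable_fun_sqrt.
  + apply: measurable_lt_set => //; apply: measurable_fun_norm.
    apply: measurable_sum => i; apply: measurable_funM => //.
    by apply: measurable_funB => //; exact: measurable_funX.
  + by apply: measurable_le_set => //; apply: measurable_funM => //;
    exact: measurable_funX.
  + move=> w /= h.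
    have q0 : 0 <= V w / D2 by rewrite divr_ge0// ltW.
    have := lt_le_trans h (norm_sqrt_sub1 q0); rewrite VE => h1.
    have [h2|h2] := ltP (eta / 2) `|\sum_(i < n) a i ^+ 2 * (X i w ^+ 2 - 1)|;
      [by left|right].
    have := lt_le_trans h1 (ler_normB _ _).
    rewrite [X in _ + X]ger0_norm ?Zn0// => h3 /=.
    lra.
  apply: (@le_trans _ _ (eta / 2 + eta / 2)); last by rewrite -splitr.
  apply: lerD.
    by apply: (wlln _ _ _ _ _ (fun i => a i ^+ 2)) => // i; exact: sqr_ge0.
  have iZn : integ P (fun w => n%:R^-1 * Z w ^+ 2) by exact: integZ.
  apply: le_trans (pr_markov iZn _ eta2) _.
    exact: Zn0.
  rewrite RintegralZl// EZ1 mulr1 mulrC ler_pdivrMr//.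
- rewrite (_ : [set w | _] = set0) ?/pr ?measure0//= ?ltW//.
  by apply/seteqP; split => // w /=; rewrite normr0 ltNge ltW.
Qed.

(** * Conditioning on the observations *)

Section frozen.
Context d (T : measurableType d) (R : realType) (P : probability T R)
  (e alpha : nat -> {RV P >-> R}).
Hypothesis ind : independent_processes P alpha e.

Local Notation Te := (g_sigma_algebraType (events_of e)).
Local Notation Ta := (g_sigma_algebraType (events_of alpha)).

Lemma events_of_measurable (X : nat -> {RV P >-> R}) (A : set T) :
  <<s events_of X >> A -> measurable A.
Proof.
apply: smallest_sub; first exact: sigma_algebra_measurable.
by move=> _ [i [_ [B mB ->]]]; rewrite -[X in measurable X]setTI;
  exact: measurable_funP.
Qed.

Lemma measurable_events_of (X : nat -> {RV P >-> R}) i :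
  measurable_fun (setT : set (g_sigma_algebraType (events_of X))) (X i.+1).
Proof.
move=> _ A mA; rewrite setTI; apply: sub_sigma_algebra.
by exists i.+1; split => //; exists A.
Qed.

Let ide : T -> Te := fun w => w.
Let ida : T -> Ta := fun w => w.

Let mide : measurable_fun setT ide.
Proof. by move=> _ A mA; rewrite setTI; exact: (@events_of_measurable e). Qed.

Let mida : measurable_fun setT ida.
Proof. by move=> _ A mA; rewrite setTI; exact: (@events_of_measurable alpha). Qed.

Let ide' : {mfun T >-> Te} := mfun_Sub (mem_set mide).
Let ida' : {mfun T >-> Ta} := mfun_Sub (mem_set mida).

Let ind_id : indep2 P ide' ida'.
Proof.
by move=> A B mA mB; rewrite setIC (ind (A := B) (B := A))// muleC.
Qed.

(** Under independence the pair (observations, multipliers) may be read off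
    from two independent sample points, so that the observations can be frozen
    while the multipliers are integrated out. *)
Lemma frozen_prob (C : set T) (F : T -> T -> R) (x p eps : R) :
  <<s events_of e >> C ->
  measurable_fun setT (fun z : Te * Ta => F z.1 z.2) ->
  (forall w, C w -> `|pr P [set w' | F w w' <= x] - p| <= eps) ->
  `|pr P (C `&` [set w | F w w <= x]) - p * pr P C| <= eps * pr P C.
Proof.
move=> sC mF FC; have mC : measurable C by exact: (@events_of_measurable e).
pose E : set (Te * Ta) := [set z | C z.1 /\ F z.1 z.2 <= x].
have mE : measurable E.
  apply: measurableI; last exact: measurable_le_set.
  rewrite -[X in measurable X]setTI.
  exact: (@measurable_fst _ _ Te Ta).
pose q (w : T) := (distribution P ida' \o xsection E) w.
have qE w : q w = (pr P [set w' | E (w, w')])%:E.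
  rewrite /q/= prK; last first.
    have mx : measurable (xsection E w) by exact: measurable_xsection.
    have := mida measurableT mx; rewrite setTI.
    by congr measurable; apply/seteqP; split=> u; rewrite /xsection/= in_setE.
  by congr (P _); apply/seteqP; split=> u; rewrite /xsection/= in_setE.
pose h (w : T) : R := pr P [set w' | E (w, w')].
have qh : q = EFin \o h by apply/funext => w; rewrite qE.
have mh : measurable_fun (setT : set T) h.
  apply/measurable_EFinP; rewrite -qh.
  exact: (measurableT_comp (measurable_fun_xsection (distribution P ida') mE) mide).
have law : pr P (C `&` [set w | F w w <= x]) = \int[P]_w h w.
  rewrite /pr /Rintegral; congr fine.
  rewrite (indep2_joint_law ind_id mE) /product_measure1.
  rewrite ge0_integral_distribution//.
    by apply: eq_integral => w _; rewrite -[RHS]/((EFin \o h) w) -qh.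
  exact: measurable_fun_xsection.
have iq : integ P h.
  apply: (@integ_bounded _ _ _ P _ 1) => // w.
  rewrite ger0_norm ?pr_ge0// -lee_fin -[leLHS]/((EFin \o h) w) -qh.
  by apply: probability_le1; exact: measurable_xsection.
have iC : integ P (\1_C : T -> R) by exact: integ_indic.
rewrite law -Rintegral_indic// -!RintegralZl//.
rewrite -RintegralB//; last exact: integZ.
apply: norm_Rintegral_le.
- by apply: integB => //; exact: integZ.
- exact: integZ.
- move=> w; rewrite indicE /h; case: (boolP (w \in C)) => Cw /=.
    rewrite !mulr1 (_ : [set w' | E (w, w')] = [set w' | F w w' <= x]).
      by apply: FC; rewrite inE in Cw.
    by apply/seteqP; split => u /=; [case|split => //; rewrite inE in Cw].
  rewrite !mulr0 subr0 (_ : [set w' | E (w, w')] = set0) ?/pr ?measure0 ?normr0//.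
  by apply/seteqP; split => // u [/= Cw']; rewrite notin_setE in Cw.
Qed.

End frozen.

Section kernel.
Context d (T : measurableType d) (R : realType) (P : probability T R)
  (e : nat -> {RV P >-> R}) (Y : T -> R)
  (k : R.-pker (g_sigma_algebraType (events_of e)) ~> R).
Hypothesis kY : conditional_law P Y k.

Local Notation Te := (g_sigma_algebraType (events_of e)).

(** Each [k w] is made a probability measure, so that the properties of
    distribution functions apply to [kcdf]. *)
Let kprob (w : T) : set R -> \bar R := k w.

HB.instance Definition _ w := Measure.on (kprob w).

Let kprobT w : kprob w setT = 1%E.
Proof. exact: prob_kernel. Qed.

HB.instance Definition _ w :=
  @Measure_isProbability.Build _ _ R (kprob w) (kprobT w).

Let idR : R -> R := idfun.

#[local] HB.instance Definition _ :=
  @isMeasurableFun.Build _ _ _ _ idR (@measurable_id _ _ setT).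

Definition kcdf (x : R) : T -> R := fun w => fine (k w `]-oo, x]%classic).

Lemma measurable_kcdf_gen x : measurable_fun (setT : set Te) (kcdf x).
Proof.
apply: (measurableT_comp (fine_measurable _)) => //.
exact: measurable_kernel.
Qed.

Lemma measurable_fun_of_gen (f : T -> R) :
  measurable_fun (setT : set Te) f -> measurable_fun (setT : set T) f.
Proof.
move=> mf _ A mA; rewrite setTI; apply: (@events_of_measurable _ _ _ _ e).
by have := mf measurableT A mA; rewrite setTI.
Qed.

Lemma measurable_kcdf x : measurable_fun (setT : set T) (kcdf x).
Proof. exact: (@measurable_fun_of_gen (kcdf x) (measurable_kcdf_gen x)). Qed.

Lemma kcdf_ge0 x w : 0 <= kcdf x w.
Proof. exact: fine_ge0. Qed.

Lemma kcdfK x w : (kcdf x w)%:E = k w `]-oo, x]%classic.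
Proof. by rewrite /kcdf fineK//; exact: (fin_num_measure (kprob w)). Qed.

Lemma kcdf_le1 x w : kcdf x w <= 1.
Proof. by rewrite -lee_fin kcdfK; exact: (probability_le1 (kprob w)). Qed.

Lemma kcdfE x w : (kcdf x w)%:E = cdf (idR : {RV kprob w >-> R}) x.
Proof. exact: kcdfK. Qed.

Lemma kcdf_nondecreasing w x y : x <= y -> kcdf x w <= kcdf y w.
Proof. by move=> xy; rewrite -lee_fin !kcdfE; exact: cdf_nondecreasing. Qed.

Lemma kcdf_right_continuous w x : kcdf y w @[y --> x^'+] --> kcdf x w.
Proof.
have := @cdf_right_continuous _ _ _ (kprob w) (idR : {RV kprob w >-> R}) x.
by rewrite -kcdfE => /fine_cvgP[].
Qed.

Lemma integ_kcdf x : integ P (kcdf x).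
Proof.
apply: (@integ_bounded _ _ _ P _ 1); first exact: measurable_kcdf.
by move=> w; rewrite ger0_norm ?kcdf_ge0 ?kcdf_le1.
Qed.

Lemma Rintegral_kcdf (C : set T) x : <<s events_of e >> C ->
  \int[P]_(w in C) kcdf x w = pr P (C `&` [set w | Y w <= x]).
Proof.
move=> sC; rewrite /Rintegral /pr.
under eq_integral do rewrite kcdfK.
by rewrite kY//; congr fine.
Qed.

(** Integrating the conditional distribution function over the observable part
    of [C] where it exceeds [p + eps] contradicts the bound on that part, unless
    the part is negligible; likewise below [p - eps]. *)
Lemma kcdf_close (C : set T) (x p eps : R) : <<s events_of e >> C -> 0 < eps ->
  (forall C', <<s events_of e >> C' -> C' `<=` C ->
    `|pr P (C' `&` [set w | Y w <= x]) - p * pr P C'| <= eps / 2 * pr P C') ->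
  pr P (C `&` [set w | eps < `|kcdf x w - p|]) = 0.
Proof.
move=> sC e0 HC.
have sig (A : set T) : @measurable _ Te A -> <<s events_of e >> A by [].
have mk := measurable_kcdf_gen x.
pose Cp : set T := C `&` [set w | p + eps < kcdf x w].
pose Cm : set T := C `&` [set w | kcdf x w < p - eps].
have sCp : <<s events_of e >> Cp.
  apply: sig; apply: measurableI => //.
  exact: (@measurable_lt_set _ Te R (fun=> p + eps) (kcdf x)).
have sCm : <<s events_of e >> Cm.
  apply: sig; apply: measurableI => //.
  exact: (@measurable_lt_set _ Te R (kcdf x) (fun=> p - eps)).
have mC := @events_of_measurable _ _ _ _ e _ sC.
have mCp := @events_of_measurable _ _ _ _ e _ sCp.
have mCm := @events_of_measurable _ _ _ _ e _ sCm.
have ik (A : set T) : measurable A -> P.-integrable A (EFin \o kcdf x).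
  by move=> mA; apply: (integrableS measurableT) => //; exact: integ_kcdf.
have ic (A : set T) (c : R) : measurable A -> P.-integrable A (EFin \o (fun _ => c)).
  by move=> mA; apply: (integrableS measurableT) => //; exact: integ_cst.
have p0 : pr P Cp = 0.
  apply/eqP; rewrite eq_le pr_ge0 andbT.
  have h1 : (p + eps) * pr P Cp <= pr P (Cp `&` [set w | Y w <= x]).
    rewrite -Rintegral_kcdf// -(Rintegral_cst P mCp).
    apply: le_Rintegral => //; [exact: ic|exact: ik|].
    by move=> w [_ /= /ltW].
  have := HC Cp sCp (@subIsetl _ _ _); rewrite ler_norml => /andP[_ h2].
  have h3 : eps / 2 * pr P Cp <= 0.
    by move: h1 h2; rewrite mulrDl; set a := pr P Cp; have := pr_ge0 P Cp; lra.
  by rewrite -(pmulr_rle0 _ (_ : 0 < eps / 2))// divr_gt0.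
have m0 : pr P Cm = 0.
  apply/eqP; rewrite eq_le pr_ge0 andbT.
  have h1 : pr P (Cm `&` [set w | Y w <= x]) <= (p - eps) * pr P Cm.
    rewrite -Rintegral_kcdf// -(Rintegral_cst P mCm).
    apply: le_Rintegral => //; [exact: ik|exact: ic|].
    by move=> w [_ /= /ltW].
  have := HC Cm sCm (@subIsetl _ _ _); rewrite ler_norml => /andP[h2 _].
  have h3 : eps / 2 * pr P Cm <= 0.
    by move: h1 h2; rewrite mulrBl; set a := pr P Cm; have := pr_ge0 P Cm; lra.
  by rewrite -(pmulr_rle0 _ (_ : 0 < eps / 2))// divr_gt0.
apply/eqP; rewrite eq_le pr_ge0 andbT -(addr0 0) -[X in X + _]p0 -[X in _ + X]m0.
apply: pr_leU => //.
  apply: measurableI => //; apply: measurable_lt_set => //.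
  apply: measurable_fun_norm; apply: measurable_funB => //; exact: measurable_kcdf.
move=> w [Cw /=]; rewrite ltNge ler_norml negb_and -!ltNge => /orP[h|h].
  by right; split => //=; lra.
by left; split => //=; lra.
Qed.

End kernel.

Section identical_laws.
Context d (T : measurableType d) (R : realType) (P : probability T R).

Lemma eq_law_integral (X Y : {RV P >-> R}) (g : R -> R) :
  (forall A : set R, measurable A -> P (X @^-1` A) = P (Y @^-1` A)) ->
  measurable_fun setT g -> (forall t, 0 <= g t) ->
  (\int[P]_w (g (X w))%:E = \int[P]_w (g (Y w))%:E)%E.
Proof.
move=> XY mg g0.
have mg' : measurable_fun setT (fun x : R => (g x)%:E) by exact/measurable_EFinP.
rewrite -(@ge0_integral_distribution _ _ _ _ _ P X (fun x => (g x)%:E))//.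
rewrite -(@ge0_integral_distribution _ _ _ _ _ P Y (fun x => (g x)%:E))//.
by apply: eq_measure_integral => A mA _; exact: XY.
Qed.

Lemma integ_of_expectation (X : T -> R) : measurable_fun setT X ->
  (forall w, 0 <= X w) -> ('E_P[X] < +oo)%E -> integ P X.
Proof.
move=> mX X0; rewrite unlock => iX; apply: integP => //.
by under eq_integral do rewrite ger0_norm//.
Qed.

Lemma Rintegral_of_expectation (X : T -> R) (c : R) :
  ('E_P[X] = c%:E)%E -> \int[P]_w X w = c.
Proof. by rewrite unlock /Rintegral => ->. Qed.

Lemma mutually_independent_shift (X : nat -> T -> R) n :
  mutually_independent P (fun i : nat => X i.+1) ->
  mutually_independent P (fun i : 'I_n => X i.+1).
Proof.
move=> ind s A us mA.
pose B (i : nat) := if insub i is Some j then A j else setT.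
have BA (i : 'I_n) : B i = A i by rewrite /B valK.
have mB i : measurable (B i) by rewrite /B; case: insubP.
have us' : uniq (map val s) by rewrite map_inj_uniq//; exact: val_inj.
have := ind (map val s) B us' mB; rewrite big_map.
under eq_bigr do rewrite BA.
move=> <-.
congr (P _); apply/seteqP; split => w Aw i /=.
  by move=> /mapP[j js ->]; rewrite BA; exact: Aw.
by move=> is_; rewrite -BA; apply: Aw => /=; exact: map_f.
Qed.

Lemma iid_noise (alpha : nat -> {RV P >-> R}) n : iid P alpha ->
  (forall i : nat, (0 < i)%N -> ('E_P[fun w => (`|alpha i w| ^+ 3)%R] < +oo)%E) ->
  (forall i : nat, (0 < i)%N -> ('E_P[alpha i] = 0)%E) ->
  (forall i : nat, (0 < i)%N -> ('E_P[fun w => (alpha i w ^+ 2)%R] = 1)%E) ->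
  standardized_noise P (fun i => alpha i.+1) n (\int[P]_w (`|alpha 1%N w| ^+ 3)).
Proof.
move=> [ind idl] E3 E1 E2; split => [i||i _].
- exact: measurable_funP.
- exact: (@mutually_independent_shift (fun i => alpha i) n ind).
have mn3 : measurable_fun setT (fun t : R => `|t| ^+ 3).
  by apply: measurable_funX; exact: measurable_fun_norm.
split.
- by apply: Rintegral_of_expectation; exact: E1.
- apply: integ_of_expectation; first exact: measurable_funX.
    by move=> w; exact: sqr_ge0.
  by rewrite E2// ltry.
- by apply: Rintegral_of_expectation; exact: E2.
- apply: integ_of_expectation => [||]; last exact: E3.
    exact: (measurableT_comp mn3).
  by move=> w; rewrite exprn_ge0.
- rewrite /Rintegral (@eq_law_integral (alpha i.+1) (alpha 1%N) (fun t => `|t| ^+ 3))//.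
  by move=> A mA; exact: idl.
Qed.

Lemma stationary_third_moment (e : nat -> {RV P >-> R}) : strictly_stationary P e ->
  (forall i : nat, (0 < i)%N -> ('E_P[fun w => (e i w ^+ 4)%R] < +oo)%E) ->
  forall i, integ P (fun w => `|e i.+1 w| ^+ 3) /\
    \int[P]_w (`|e i.+1 w| ^+ 3) = \int[P]_w (`|e 1%N w| ^+ 3).
Proof.
move=> stat E4 i.
have mn3 : measurable_fun setT (fun t : R => `|t| ^+ 3).
  by apply: measurable_funX; exact: measurable_fun_norm.
split.
  have i4 : integ P (fun w => e i.+1 w ^+ 4).
    apply: integ_of_expectation; last exact: E4.
      exact: measurable_funX.
    by move=> w; rewrite exprn_even_ge0.
  apply: (integ_le _ (integD (integ_cst P 1) i4)) => [|w].
    exact: (measurableT_comp mn3).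
  rewrite normrX normr_id [leRHS]ger0_norm; last first.
    by rewrite addr_ge0// exprn_even_ge0.
  rewrite (_ : e i.+1 w ^+ 4 = (`|e i.+1 w| ^+ 2) ^+ 2); last first.
    by rewrite real_normK ?num_real// -exprM.
  have : 0 <= `|e i.+1 w| by [].
  set u := `|_| => u0.
  (* [u ^+ 3 <= 1 + u ^+ 4] *)
  have := sqr_ge0 (u * (u - 1)); have := sqr_ge0 (u ^+ 2 - 1);
    have := sqr_ge0 (u ^+ 2).
  by move=> h1 h2 h3; lra.
rewrite /Rintegral (@eq_law_integral (e i.+1) (e 1%N) (fun t => `|t| ^+ 3))//.
move=> A mA; have := @same_law_pr _ _ _ _ _ P P _ _ (stat i) 1%N
  (fun t => tnth t ord0) A (measurable_tnth ord0) mA.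
under eq_set do rewrite tnth_mktuple/=.
under [X in _ = pr _ X -> _]eq_set do rewrite tnth_mktuple/= add1n.
move=> eA; rewrite -[LHS]prK;
  last by rewrite -[X in measurable X]setTI; exact: measurable_funP.
rewrite -[RHS]prK; last by rewrite -[X in measurable X]setTI; exact: measurable_funP.
by congr (_%:E).
Qed.

End identical_laws.

Section conditional_clt.
Context d (T : measurableType d) (R : realType) (P : probability T R)
  (e alpha : nat -> {RV P >-> R}) (sigma : nat -> nat -> R)
  (Pstar : nat -> R.-pker (g_sigma_algebraType (events_of e)) ~> R) (C3 M : R).
Hypothesis sigma0 : forall n i : nat, (1 <= i <= n)%N -> 0 < sigma n i.
Hypothesis ratio : sum_pow sigma 3 n / Sigma sigma n ^+ 3 @[n --> \oo] --> (0 : R).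
Hypothesis sqr_pr : forall eta : R, 0 < eta ->
  pr P [set w | eta < `|sum_sqr e sigma n w / Sigma sigma n ^+ 2 - 1|]
    @[n --> \oo] --> (0 : R).
Hypothesis e3 : forall i, integ P (fun w => `|e i.+1 w| ^+ 3) /\
  \int[P]_w (`|e i.+1 w| ^+ 3) = C3.
Hypothesis ind : independent_processes P alpha e.
Hypothesis M0 : 0 <= M.
Hypothesis noise : forall n, standardized_noise P (fun i => alpha i.+1) n M.
Hypothesis Pstar_law : forall n, conditional_law P (H_star sigma e alpha n) (Pstar n).

Local Notation Te := (g_sigma_algebraType (events_of e)).
Local Notation Ta := (g_sigma_algebraType (events_of alpha)).

Let frozen n (w w' : T) := tstat n (fun i => (sigma n i.+1 * e i.+1 w) * alpha i.+1 w').

Let H_starE n w : H_star sigma e alpha n w = frozen n w w.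
Proof.
rewrite /H_star /frozen /tstat /xi_bar /xi !sum1E.
by congr (_ / Num.sqrt _); apply: eq_bigr => i _; rewrite sum1E.
Qed.

Let measurable_frozen n : measurable_fun setT (fun z : Te * Ta => frozen n z.1 z.2).
Proof.
apply: measurable_tstat => i; apply: measurable_funM.
  apply: measurable_funM => //.
  exact: (measurableT_comp (@measurable_events_of _ _ _ P e i) (@measurable_fst _ _ Te Ta)).
exact: (measurableT_comp (@measurable_events_of _ _ _ P alpha i) (@measurable_snd _ _ Te Ta)).
Qed.

Let cubes n (w : T) := \sum_(i < n) `|sigma n i.+1 * e i.+1 w| ^+ 3.

Let integ_cubes n : integ P (cubes n) /\ \int[P]_w cubes n w = C3 * sum_pow sigma 3 n.
Proof.
have ic (i : 'I_n) : integ P (fun w => `|sigma n i.+1 * e i.+1 w| ^+ 3) /\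
    \int[P]_w (`|sigma n i.+1 * e i.+1 w| ^+ 3) = sigma n i.+1 ^+ 3 * C3.
  have s0 : 0 <= sigma n i.+1 by rewrite ltW// sigma0/=.
  have [ie <-] := e3 i.
  have E : (fun w => `|sigma n i.+1 * e i.+1 w| ^+ 3)
      = (fun w => sigma n i.+1 ^+ 3 * `|e i.+1 w| ^+ 3).
    by apply/funext => w; rewrite normrM (ger0_norm s0) exprMn.
  by rewrite E; split; [exact: integZ|rewrite RintegralZl].
split; first by apply: integ_sum => i; exact: (ic i).1.
rewrite Rintegral_sum_prob => [|i]; last exact: (ic i).1.
rewrite sum_powE mulr_sumr; apply: eq_bigr => i _.
by rewrite (ic i).2 mulrC.
Qed.

(** Lyapunov's condition with constant [kappa] for the weights [sigma_i e_i]. *)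
Let good (kappa : R) n : set T := [set w | 0 < sum_sqr e sigma n w] `&`
  [set w | cubes n w <= kappa * Num.sqrt (sum_sqr e sigma n w) ^+ 3].

Let measurable_sum_sqr_gen n : measurable_fun (setT : set Te) (sum_sqr e sigma n).
Proof.
apply: measurable_sum => i; apply: measurable_funX; apply: measurable_funM => //.
exact: measurable_events_of.
Qed.

Let good_events kappa n : <<s events_of e >> (good kappa n).
Proof.
suff : @measurable _ Te (good kappa n) by [].
apply: measurableI.
  exact: (@measurable_lt_set _ Te R (fun=> 0) (sum_sqr e sigma n)).
apply: (@measurable_le_set _ Te R (cubes n)).
  apply: measurable_sum => i; apply: measurable_funX; apply: measurable_fun_norm.
  by apply: measurable_funM => //; exact: measurable_events_of.
apply: measurable_funM => //; apply: measurable_funX.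
by apply: measurable_fun_sqrt; exact: measurable_sum_sqr_gen.
Qed.

(** With probability close to one [sum_sqr] is at least [Sigma ^+ 2 / 2], hence
    its square root at least [Sigma / 2], whose cube yields the constant 8; the
    cubes are then controlled by Markov's inequality. *)
Let cvg_good kappa : 0 < kappa ->
  pr P (~` good kappa n) @[n --> \oo] --> (0 : R).
Proof.
move=> k0; have k8 : 0 < kappa / 8 by rewrite divr_gt0.
have half0 : 0 < 2^-1 :> R by rewrite invr_gt0.
have C30 : 0 <= C3.
  by have [_ <-] := e3 0; apply: Rintegral_ge0 => w _; rewrite exprn_ge0.
have lim : pr P [set w | 2^-1 < `|sum_sqr e sigma n w / Sigma sigma n ^+ 2 - 1|]
    + (kappa / 8)^-1 * C3 * (sum_pow sigma 3 n / Sigma sigma n ^+ 3) @[n --> \oo]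
    --> 0 + (kappa / 8)^-1 * C3 * 0.
  apply: cvgD; first exact: sqr_pr.
  by apply: cvgM; [exact: cvg_cst|exact: ratio].
rewrite mulr0 addr0 in lim.
apply: (@squeeze_cvgr _ _ _ _ (fun=> 0) _ _ _ _ _ lim); last exact: cvg_cst.
near=> n; rewrite pr_ge0/=.
have n0 : (0 < n)%N by near: n; exists 1%N.
have S0 := Sigma_gt0 sigma0 n0.
have S3 : 0 < Sigma sigma n ^+ 3 by rewrite exprn_gt0.
have [iQ EQ] := integ_cubes n.
have iQ' : integ P (fun w => (Sigma sigma n ^+ 3)^-1 * cubes n w) by exact: integZ.
have Q0 w : 0 <= (Sigma sigma n ^+ 3)^-1 * cubes n w.
  rewrite mulr_ge0 ?invr_ge0 ?(ltW S3)//; apply: sumr_ge0 => i _.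
  by rewrite exprn_ge0.
have mS : measurable_fun setT (fun w => sum_sqr e sigma n w / Sigma sigma n ^+ 2 - 1).
  apply: measurable_funB => //; apply: measurable_funM => //.
  exact: measurable_sum_sqr.
apply: (@le_trans _ _ (pr P [set w | 2^-1 < `|sum_sqr e sigma n w / Sigma sigma n ^+ 2 - 1|]
    + pr P [set w | kappa / 8 <= (Sigma sigma n ^+ 3)^-1 * cubes n w])).
  apply: pr_leU.
  - apply: measurableC; exact: (@events_of_measurable _ _ _ P e _ (good_events _ _)).
  - by apply: measurable_lt_set => //; exact: measurable_fun_norm.
  - by apply: measurable_le_set => //; exact: (integ_measurable iQ').
  move=> w; have [h|h] := ltP 2^-1 `|sum_sqr e sigma n w / Sigma sigma n ^+ 2 - 1|;
    first by left.
  move=> badw; right; rewrite /= leNgt; apply/negP => h2; apply: badw.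
  have D2 : Sigma sigma n ^+ 2 / 2 <= sum_sqr e sigma n w.
    move: h; rewrite ler_norml => /andP[h _].
    have : 2^-1 <= sum_sqr e sigma n w / Sigma sigma n ^+ 2 by lra.
    by rewrite ler_pdivlMr ?exprn_gt0// mulrC.
  have S20 : 0 < Sigma sigma n ^+ 2 by rewrite exprn_gt0.
  have D0 : 0 < sum_sqr e sigma n w by lra.
  split => //=.
  have D1 : Sigma sigma n / 2 <= Num.sqrt (sum_sqr e sigma n w).
    rewrite -(@ler_pXn2r _ 2) ?nnegrE ?sqrtr_ge0 ?divr_ge0 ?(ltW S0)//.
    rewrite sqr_sqrtr ?(ltW D0)// exprMn exprVn; lra.
  have D3 : (Sigma sigma n / 2) ^+ 3 <= Num.sqrt (sum_sqr e sigma n w) ^+ 3.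
    by rewrite lerXn2r ?nnegrE ?sqrtr_ge0 ?divr_ge0 ?(ltW S0).
  apply: le_trans (ler_wpM2l (ltW k0) D3).
  move: h2; rewrite mulrC ltr_pdivrMr// => /ltW; rewrite exprMn exprVn.
  by have -> : kappa * (Sigma sigma n ^+ 3 / 2 ^+ 3)
    = kappa / 8 * Sigma sigma n ^+ 3 by field.
rewrite lerD2l; apply: le_trans (pr_markov iQ' Q0 k8) _.
rewrite RintegralZl// EQ le_eqVlt; apply/orP; left; apply/eqP; ring.
Unshelve. all: by end_near. Qed.

(** On the observable event [good] the weights frozen at the observations
    satisfy Lyapunov's condition, so the conditional distribution function is
    close to [Phi] there. *)
Lemma conditional_clt (x eps : R) : 0 < eps ->
  pr P [set w | eps < `|kcdf (Pstar n) x w - Phi x|] @[n --> \oo] --> (0 : R).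
Proof.
move=> eps0; have eps2 : 0 < eps / 2 by rewrite divr_gt0.
have [kappa k0 mclt] := multiplier_clt x eps2 M0.
apply: (@squeeze_cvgr _ _ _ _ (fun=> 0) _ _ _ _ _ (cvg_good k0)); last exact: cvg_cst.
near=> n; rewrite pr_ge0/=.
have n0 : (0 < n)%N by near: n; exists 1%N.
have nk : n%:R^-1 <= kappa.
  rewrite -[leRHS]invrK lef_pV2 ?posrE ?invr_gt0 ?ltr0n//.
  by near: n; exact: nbhs_infty_ger.
have sG := good_events kappa n.
have mG := @events_of_measurable _ _ _ P e _ sG.
have mk : measurable [set w | eps < `|kcdf (Pstar n) x w - Phi x|].
  apply: measurable_lt_set => //; apply: measurable_fun_norm.
  by apply: measurable_funB => //; exact: measurable_kcdf.
have close := @kcdf_close _ _ _ P e (H_star sigma e alpha n) (Pstar n)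
  (Pstar_law n) (good kappa n) x (Phi x) eps sG eps0.
rewrite -[leRHS]add0r -{1}close; last first.
  move=> C sC Cgood; under eq_set do rewrite H_starE.
  apply: (frozen_prob ind sC (@measurable_frozen n)) => w /Cgood[D0 s3].
  exact: mclt.
apply: pr_leU => //.
- exact: measurableI.
- exact: measurableC.
- by move=> w bad; have [Gw|Gw] := pselect (good kappa n w); [left|right].
Unshelve. all: by end_near. Qed.

End conditional_clt.

(** * From pointwise to uniform convergence *)

Section polya.
Context (R : realType).
Local Notation Phi := (@Phi R).

Lemma Phi_lipschitz (x y : R) : `|Phi y - Phi x| <= `|y - x|.
Proof.
rewrite -[leRHS]mul1r; apply: (@mvt_bound R Phi (@phi R)) => t _.
  exact: is_derive_Phi.
by rewrite ger0_norm ?phi_ge0 ?phi_le1.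
Qed.

(** Polya: closeness to the continuous distribution function [Phi] on a finite
    grid implies uniform closeness, by monotonicity. *)
Lemma polya_grid (eps : R) : 0 < eps -> exists (m : nat) (t : nat -> R),
  forall F : R -> R, {homo F : x y / x <= y} -> (forall x, 0 <= F x <= 1) ->
  (forall i : 'I_m.+1, `|F (t i) - Phi (t i)| <= eps) ->
  forall x, `|F x - Phi x| <= 2 * eps.
Proof.
move=> e0; have [A A0 [A1 A2]] := @Phi_tails R _ e0.
pose m := Num.bound (2 * A / eps); pose t (i : nat) := - A + i%:R * eps.
have tm : A <= t m.
  have : 2 * A / eps <= m%:R.
    rewrite ltW// archi_boundP// divr_ge0 ?(ltW e0)//; lra.
  by rewrite ler_pdivrMr// /t; lra.
exists m, t => F F_nd F01 Ft x.
have t0 : t 0%N = - A by rewrite /t mul0r addr0.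
have /andP[F0 F1] := F01 x; have P0 := @Phi_ge0 R x; have P1 := @Phi_le1 R x.
have [xA|Ax] := leP x (- A).
  have := Ft ord0; rewrite t0 ler_norml => /andP[_ h].
  have h1 := F_nd _ _ xA; have h2 := @Phi_nondecreasing R _ _ xA.
  by rewrite ler_norml; apply/andP; split; lra.
have [tx|xt] := leP (t m) x.
  have := Ft ord_max; rewrite ler_norml => /andP[h _].
  have h1 := F_nd _ _ tx; have h2 := @Phi_nondecreasing R _ _ tx.
  have h3 := @Phi_nondecreasing R _ _ tm.
  rewrite /= in h.
  by rewrite ler_norml; apply/andP; split; lra.
pose i := Num.truncn ((x + A) / eps).
have /andP[i1 i2] : i%:R <= (x + A) / eps < i.+1%:R.
  by apply: truncn_itv; rewrite divr_ge0 ?(ltW e0)//; lra.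
have ti : t i <= x by move: i1; rewrite ler_pdivlMr// /t; lra.
have ti1 : x <= t i.+1 by move: i2; rewrite ltr_pdivrMr// /t => ?; lra.
have im : (i < m)%N.
  rewrite ltnNge; apply/negP => mi; move: xt; rewrite ltNge => /negP; apply.
  by apply: le_trans ti; rewrite /t lerD2l ler_pM2r// ler_nat.
have step : `|Phi (t i.+1) - Phi (t i)| <= eps.
  apply: le_trans (Phi_lipschitz _ _) _.
  rewrite (_ : t i.+1 - t i = eps) ?gtr0_norm//.
  by rewrite /t -natr1; ring.
have := Ft (Ordinal (ltnW im : (i < m.+1)%N));
  have := Ft (Ordinal (im : (i.+1 < m.+1)%N)).
move: step; rewrite /= !ler_norml => /andP[s1 s2] /andP[h1 h2] /andP[h3 h4].
have f1 := F_nd _ _ ti; have f2 := F_nd _ _ ti1.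
have p1 := @Phi_nondecreasing R _ _ ti; have p2 := @Phi_nondecreasing R _ _ ti1.
by apply/andP; split; lra.
Qed.

Lemma pr_bigsetU d (T : measurableType d) (P : probability T R) m (B : nat -> set T) :
  (forall i, measurable (B i)) ->
  pr P (\big[setU/set0]_(i < m) B i) <= \sum_(i < m) pr P (B i).
Proof.
move=> mB; elim: m => [|m IH]; first by rewrite !big_ord0 /pr measure0.
rewrite !big_ord_recr/=.
have mU : measurable (\big[setU/set0]_(i < m) B i) by exact: bigsetU_measurable.
apply: le_trans (pr_leU P _ mU (mB m) (@subset_refl _ _)) _; last by rewrite lerD2r.
exact: measurableU.
Qed.

End polya.

Section sup_distance.
Context d (T : measurableType d) (R : realType) (P : probability T R).
Variables (F : R -> T -> R) (G : R -> R).
Hypothesis mF : forall x, measurable_fun setT (F x).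
Hypothesis F01 : forall x w, 0 <= F x w <= 1.
Hypothesis G01 : forall x, 0 <= G x <= 1.
Hypothesis F_rc : forall x w, F y w @[y --> x^'+] --> F x w.
Hypothesis G_rc : forall x, G y @[y --> x^'+] --> G x.

Let dist w : set R := range (fun x => `|F x w - G x|).

Let dist0 w : dist w !=set0.
Proof. by exists `|F 0 w - G 0|; exists 0. Qed.

Let dist_ub w : has_ubound (dist w).
Proof.
exists 1 => _ [x _ <-]; have := F01 x w; have := G01 x.
by move=> /andP[? ?] /andP[? ?]; rewrite ler_norml; apply/andP; split; lra.
Qed.

Lemma sup_distance_ge0 w : 0 <= sup (dist w).
Proof.
apply: le_trans (_ : `|F 0 w - G 0| <= _); first exact: normr_ge0.
by apply: ub_le_sup => //; exists 0.
Qed.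

Lemma sup_distance_le w (c : R) : (forall x, `|F x w - G x| <= c) -> sup (dist w) <= c.
Proof. by move=> h; apply: ge_sup => // _ [x _ <-]. Qed.

(** Right continuity reduces the supremum to rational points, which makes the
    uniform distance measurable. *)
Lemma measurable_sup_distance (eps : R) : measurable [set w | eps < `|sup (dist w) - 0|].
Proof.
rewrite (_ : [set w | _]
  = \bigcup_(q : rat) [set w | eps < `|F (ratr q) w - G (ratr q)|]).
  apply: bigcupT_measurable_rat => q.
  apply: measurable_lt_set => //; apply: measurable_fun_norm.
  exact: measurable_funB.
apply/seteqP; split => w /=.
  rewrite subr0 ger0_norm ?sup_distance_ge0// => h.
  have [x hx] : exists x, eps < `|F x w - G x|.
    apply: contrapT => /forallNP hN; move: h; rewrite ltNge => /negP; apply.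
    by apply: sup_distance_le => x; rewrite leNgt; apply/negP; exact: hN.
  have lim : `|F y w - G y| @[y --> x^'+] --> `|F x w - G x|.
    by apply: cvg_norm; apply: cvgB; [exact: F_rc|exact: G_rc].
  have [r /= r0 rP] : \forall y \near x^'+, eps < `|F y w - G y| by exact: (cvgr_gt _ lim).
  have xr : x < x + r by rewrite ltrDl.
  have [q] := rat_in_itvoo xr; rewrite in_itv/= => /andP[xq qr].
  exists q => //=; apply: rP => //=.
  by rewrite distrC gtr0_norm ?subr_gt0//; lra.
move=> [q _ /= h]; rewrite subr0 ger0_norm ?sup_distance_ge0//.
apply: lt_le_trans h _; apply: ub_le_sup => //; by exists (ratr q).
Qed.

End sup_distance.

Lemma cvg0_sum (R : realType) m (u : nat -> nat -> R) :
  (forall i : 'I_m, u i n @[n --> \oo] --> (0 : R)) ->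
  \sum_(i < m) u i n @[n --> \oo] --> (0 : R).
Proof.
elim: m => [|m IH] H.
  by under eq_fun do rewrite big_ord0; exact: cvg_cst.
under eq_fun do rewrite big_ord_recr/=.
have h := cvgD (IH (fun i => H (widen_ord (leqnSn m) i))) (H ord_max).
by rewrite addr0 in h; exact: h.
Qed.

Theorem theorem2p2 (R : realType) (d : measure_display) (T : measurableType d)
  (P : probability T R) (e : nat -> {RV P >-> R}) (sigma : nat -> nat -> R)
  (tau tau_star : R) (alpha tau_hat : nat -> {RV P >-> R})
  (Pstar : nat -> R.-pker (g_sigma_algebraType (events_of e)) ~> R) :
  strictly_stationary P e ->
  (forall i : nat, (0 < i)%N -> ('E_P[e i] = 0)%E) ->
  (forall i : nat, (0 < i)%N -> ('E_P[fun w => (e i w ^+ 2)%R] = 1)%E) ->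
  (forall i : nat, (0 < i)%N -> ('E_P[fun w => (e i w ^+ 4)%R] < +oo)%E) ->
  0 < tau -> has_long_run_variance P e (tau ^+ 2) ->
  0 <= tau_star ->
  has_long_run_variance P (fun i w => e i w ^+ 2 - 1) (tau_star ^+ 2) ->
  (forall n i : nat, (1 <= i <= n)%N -> 0 < sigma n i) ->
  strong_invariance e (fun x => x) tau (Delta R) ->
  strong_invariance e (fun x => x ^+ 2 - 1) tau_star (Delta R) ->
  variation_pow sigma 1 n * Delta R n / Sigma sigma n
    + (variation_pow sigma 2 n * Delta R n + Sigma_star2 sigma n)
      / Sigma sigma n ^+ 2 @[n --> \oo] --> (0 : R) ->
  sum_pow sigma 3 n ^+ 2 * sum_pow sigma 2 n ^- 3 @[n --> \oo] --> (0 : R) ->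
  iid P alpha ->
  independent_processes P alpha e ->
  (forall i : nat, (0 < i)%N -> ('E_P[fun w => (`|alpha i w| ^+ 3)%R] < +oo)%E) ->
  (forall i : nat, (0 < i)%N -> ('E_P[alpha i] = 0)%E) ->
  (forall i : nat, (0 < i)%N -> ('E_P[fun w => (alpha i w ^+ 2)%R] = 1)%E) ->
  cvg_in_probability P tau_hat tau ->
  (forall n : nat, conditional_law P (H_star sigma e alpha n) (Pstar n)) ->
  cvg_in_probability P
    (fun n w =>
       sup (range (fun x : R =>
         `|fine (Pstar n w `]-oo, x]%classic)
           - fine (P [set w' | H sigma e n w' / tau_hat n w' <= x])|)))
    0.
Proof.
move=> stat e_mean e_var e4 tau0 _ ts0 _ sigma0 sip sip_sq rate lyap alpha_iid
  ind alpha3 alpha_mean alpha_var tau_cons Pstar_law eps eps0.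
pose M := \int[P]_w (`|alpha 1%N w| ^+ 3).
have M0 : 0 <= M by apply: Rintegral_ge0 => w _; rewrite exprn_ge0.
have noise n := iid_noise n alpha_iid alpha3 alpha_mean alpha_var.
have e3 := stationary_third_moment stat e4.
have den eta : 0 < eta -> _ := fun eta0 =>
  denominator_pr sigma0 rate ts0 sip_sq eta0.
have num x c : 0 < c -> _ := fun c0 => numerator_clt sigma0 rate lyap tau0 x sip c0.
have sqr_pr eta : 0 < eta -> _ := fun eta0 => sum_sqr_pr sigma0 den eta0.
have cond x c : 0 < c -> _ := fun c0 => conditional_clt sigma0 (lyapunov_ratio sigma0 lyap)
  sqr_pr e3 ind M0 noise Pstar_law x c0.
have stud x c : 0 < c -> _ := fun c0 => studentized_clt sigma0 tau0 num den x tau_cons c0.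
(* Two errors [eps / 4] on the grid, each doubled between grid points. *)
have eps4 : 0 < eps / 4 by rewrite divr_gt0.
have [m [t grid]] := polya_grid eps4.
pose Y n w := H sigma e n w / tau_hat n w.
have mY n : measurable_fun setT (Y n).
  by apply: measurable_fun_div => //; exact: measurable_H.
pose Y' n : {RV P >-> R} := mfun_Sub (mem_set (mY n)).
pose G n x := pr P [set w | Y n w <= x].
have GE n x : (G n x)%:E = cdf (Y' n) x.
  by rewrite /G prK//; exact: measurable_le_set.
have G01 n x : 0 <= G n x <= 1.
  by rewrite pr_ge0 pr_le1//; exact: measurable_le_set.
have G_nd n : {homo G n : x y / x <= y}.
  by move=> x y xy; rewrite -lee_fin !GE; exact: cdf_nondecreasing.
have G_rc n x : G n y @[y --> x^'+] --> G n x.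
  have := @cdf_right_continuous _ _ _ P (Y' n) x.
  by rewrite -GE => /fine_cvgP[].
have k01 n x w : 0 <= kcdf (Pstar n) x w <= 1 by rewrite kcdf_ge0 kcdf_le1.
have mk n x : measurable_fun setT (kcdf (Pstar n) x) by exact: measurable_kcdf.
have k_nd n w : {homo (fun x => kcdf (Pstar n) x w) : x y / x <= y}.
  by move=> x y xy; exact: kcdf_nondecreasing.
have k_rc n x w : kcdf (Pstar n) y w @[y --> x^'+] --> kcdf (Pstar n) x w.
  exact: kcdf_right_continuous.
have mdist n := measurable_sup_distance (mk n) (k01 n) (G01 n) (@k_rc n) (@G_rc n) eps.
pose far n i := [set w | eps / 4 < `|kcdf (Pstar n) (t i) w - Phi (t i)|].
have mfar n i : measurable (far n i).
  apply: measurable_lt_set => //; apply: measurable_fun_norm.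
  exact: measurable_funB.
have lim : \sum_(i < m.+1) pr P (far n i) @[n --> \oo] --> (0 : R).
  by apply: (@cvg0_sum R m.+1 (fun i n => pr P (far n i))) => i; exact: cond.
have lim_pr : pr P [set w | eps < `|sup (range (fun x => `|kcdf (Pstar n) x w - G n x|)) - 0|]
    @[n --> \oo] --> (0 : R).
  apply: (@squeeze_cvgr _ _ _ _ (fun=> 0) _ _ _ _ _ lim); last exact: cvg_cst.
  near=> n; rewrite pr_ge0/=.
  have Gt : forall i : 'I_m.+1, `|G n (t i) - Phi (t i)| <= eps / 4.
    by near: n; apply: filter_forall => i; exact: stud.
  apply: le_trans (pr_bigsetU P m.+1 (mfar n)).
  apply: pr_le => //; first exact: bigsetU_measurable.
  move=> w; rewrite /= subr0 ger0_norm;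
    last exact: sup_distance_ge0 (k01 n) (G01 n) w.
  apply: contraPP => nfar; apply/negP; rewrite -leNgt.
  have kt (i : 'I_m.+1) : `|kcdf (Pstar n) (t i) w - Phi (t i)| <= eps / 4.
    rewrite leNgt; apply/negP => h; apply: nfar.
    by rewrite -bigcup_mkord; exists (i : nat); first exact: (ltn_ord i).
  apply: sup_distance_le => x.
  have h1 := grid _ (@k_nd n w) (k01 n ^~ w) kt x.
  have h2 := grid _ (G_nd n) (G01 n) Gt x.
  apply: le_trans (ler_distD (Phi x) _ _) _.
  by rewrite distrC in h2; lra.
apply/fine_cvgP; split; last exact: lim_pr.
by near=> n; apply: fin_num_measure; exact: mdist n.
Unshelve. all: by end_near. Qed.
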